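(* Let $\gamma:[0,\ell_\gamma]\to\mathbb R$ be a normalised profile function. Take $t_0\in(0,\ell_\gamma)$ such that $\dot\gamma(t_0)\ne0$ and let $m_{t_0}:=\left|\frac{\gamma(t_0)}{\dot\gamma(t_0)}\right|$. The lift to $SS^2_\gamma$ of the latitude curve $\{t=t_0\}$, parametrised by arc length and oriented by $(\operatorname{sign}\dot\gamma(t_0))\,\partial_\theta$, is the support of a periodic orbit of $X^{m_{t_0}}_\gamma$. Let $\zeta_{t_0}$ be the associated invariant probability measure. Its action is $$\mathcal A(\zeta_{t_0})=\frac{\gamma(t_0)^2-\dot\gamma(t_0)\Gamma(t_0)}{\dot\gamma(t_0)^2},$$ and $I_{m_{t_0},\gamma}|_{\operatorname{supp}\zeta_{t_0}}=\dot\gamma(t_0)\,\mathcal A(\zeta_{t_0})$. As a result, if $K_{m_{t_0}}>0$, then $\mathcal A(\zeta_{t_0})>0$.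
   Context: A normalised profile function is a smooth $\gamma:[0,\ell_\gamma]\to\mathbb R$ such that: $\gamma(0)=\gamma(\ell_\gamma)=0$ and $\gamma>0$ on $(0,\ell_\gamma)$; $\dot\gamma(0)=1$, $\dot\gamma(\ell_\gamma)=-1$ and $|\dot\gamma|<1$ on $(0,\ell_\gamma)$; all even derivatives of $\gamma$ vanish at $0$ and $\ell_\gamma$; $\int_0^{\ell_\gamma}\gamma\,dt=2$. $S^2_\gamma$ is the quotient of $[0,\ell_\gamma]\times\mathbb R/2\pi\mathbb Z$ (coordinates $(t,\theta)$, orientation $dt\wedge d\theta$) collapsing each boundary circle to a pole, with metric $g_\gamma=dt^2+\gamma^2d\theta^2$, area form $\mu_\gamma=\gamma\,dt\wedge d\theta$, curvature $K=-\ddot\gamma/\gamma$. $\Gamma$ is the primitive of $\gamma$ with $\Gamma(0)=-1$. On the unit tangent bundle $\pi:SS^2_\gamma\to S^2_\gamma$ use, away from the poles, coordinates $(t,\varphi,\theta)$ with $\varphi$ the oriented angle from $\partial_t$ to the vector. $X$ is the geodesic vector field, $V=\partial_\varphi$ the generator of fibre rotation, $\lambda_{(x,v)}(\xi)=g_\gamma(v,d\pi\,\xi)$. For $m>0$ let $X^m_\gamma=mX+V$, which spans the kernel of $\omega'_{m,\gamma}=m\,d\lambda-\pi^*\mu_\gamma$ on $SS^2_\gamma$ (the magnetic system $(S^2_\gamma,g_\gamma,\mu_\gamma)$ at energy $m^2/2$, rescaled to the unit tangent bundle). $\omega'_{m,\gamma}$ is exact; the action of an $X^m_\gamma$-invariant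 Borel probability measure $\zeta$ is $\mathcal A(\zeta)=\int_{SS^2_\gamma}\alpha(X^m_\gamma)\,d\zeta$ for any primitive $\alpha$ of $\omega'_{m,\gamma}$ (independent of $\alpha$ since $H^1(SS^2_\gamma;\mathbb R)=0$). $I_{m,\gamma}:SS^2_\gamma\to\mathbb R$ is the integral of motion given in coordinates by $I_{m,\gamma}=m\gamma(t)\sin\varphi-\Gamma(t)$. The magnetic curvature is $K_m=m^2K+1$, and $K_m>0$ means positivity everywhere. *)

(* Defs.v *)
(* MathComp / MathComp-Analysis *)
From HB Require Import structures.
From mathcomp Require Import all_boot all_order all_algebra.
From mathcomp Require Import generic_quotient.
From mathcomp Require Import all_classical all_reals all_analysis.
From mathcomp Require Import ring.
Set Implicit Arguments.
Unset Strict Implicit.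
Unset Printing Implicit Defensive.
Import Order.TTheory GRing.Theory Num.Theory.
Import numFieldNormedType.Exports.
Local Open Scope classical_set_scope.
Local Open Scope ring_scope.

(* A smooth function on [0, l] is represented by a smooth extension to R; only
   its values on [0, l] are used, and its derivatives at the end points are
   then the one-sided ones. *)
Definition profile (R : realType) (l : R) (g : R -> R) : Prop :=
  [/\ 0 < l /\ (forall n x, derivable (derive1n n g) x 1),
      [/\ g 0 = 0, g l = 0 & forall t, 0 < t < l -> 0 < g t],
      [/\ derive1 g 0 = 1, derive1 g l = -1 & forall t, 0 < t < l -> `|derive1 g t| < 1],
      (forall k, derive1n k.*2 g 0 = 0 /\ derive1n k.*2 g l = 0) &
      \int[lebesgue_measure]_(t in `[0, l]) g t = 2].

Definition prim (R : realType) (g : R -> R) (t : R) : R :=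
  -1 + \int[lebesgue_measure]_(s in `[0, t]) g s.

(* K depends on the latitude t only; the limit along ]0, l[ is - g'' / g in the
   interior and the value by continuity at the poles t = 0 and t = l. *)
Definition curvature (R : realType) (l : R) (g : R -> R) (t : R) : R :=
  lim ((fun s => - derive1n 2 g s / g s) @ within `]0, l[ (nbhs t)).

Definition magnetic_curvature (R : realType) (l : R) (g : R -> R) (m t : R) : R :=
  m ^+ 2 * curvature l g t + 1.

Definition vec3 (R : realType) (a b c : R) : 'rV[R]_3 :=
  \row_(i < 3) [:: a; b; c]`_i.

Notation co0 p := (p ord0 (0 : 'I_3)).
Notation co1 p := (p ord0 (1 : 'I_3)).
Notation co2 p := (p ord0 (2 : 'I_3)).

(** The unit tangent bundle as a quotient of [0, l] x R x R *)

(* The triple (t, phi, theta) is the unit vector at the point (t, theta) making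
   the oriented angle phi with d/dt.  Over the pole t = 0 it is the vector
   making the angle phi with the meridian of longitude theta, so that only
   phi + theta matters; over t = l only phi - theta matters, since there the
   meridians turn clockwise as theta grows.  Triples with t outside [0, l] are
   sent to the nearest end point. *)
Definition clamp (R : realType) (l t : R) : R := Num.max 0 (Num.min t l).

Definition eq_angle (R : realType) (a b : R) : Prop :=
  exists k : int, b = a + 2 * pi * k%:~R.

Lemma eq_angle_refl (R : realType) (a : R) : eq_angle a a.
Proof. by exists 0; rewrite mulr0 addr0. Qed.

Lemma eq_angle_sym (R : realType) (a b : R) : eq_angle a b -> eq_angle b a.
Proof. by case=> k ->; exists (- k); rewrite rmorphN /= mulrN addrK. Qed.

Lemma eq_angle_trans (R : realType) (b a c : R) :
  eq_angle a b -> eq_angle b c -> eq_angle a c.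
Proof. by case=> k -> [j ->]; exists (k + j); rewrite intrD; ring. Qed.

Definition same_vector (R : realType) (l : R) (p q : 'rV[R]_3) : Prop :=
  clamp l (co0 p) = clamp l (co0 q) /\
  if clamp l (co0 p) == 0 then eq_angle (co1 p + co2 p) (co1 q + co2 q)
  else if clamp l (co0 p) == l then eq_angle (co1 p - co2 p) (co1 q - co2 q)
  else eq_angle (co1 p) (co1 q) /\ eq_angle (co2 p) (co2 q).

Definition same_vectorb (R : realType) (l : R) (p q : 'rV[R]_3) : bool :=
  `[< same_vector l p q >].

Lemma same_vector_equiv (R : realType) (l : R) :
  equiv_class_of (@same_vectorb R l).
Proof.
have sym p q : same_vector l p q -> same_vector l q p.
  move=> [e]; rewrite /same_vector -e => h; split=> //.
  move: h; case: ifP => _; first exact: eq_angle_sym.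
  case: ifP => _; first exact: eq_angle_sym.
  by move=> [h1 h2]; split; exact: eq_angle_sym.
split.
- move=> p; apply/asboolP; split=> //.
  case: ifP => _; first exact: eq_angle_refl.
  case: ifP => _; first exact: eq_angle_refl.
  by split; exact: eq_angle_refl.
- by move=> p q; apply/asboolP/asboolP; exact: sym.
- move=> q p r /asboolP [e1 h1] /asboolP [e2 h2]; apply/asboolP.
  split; first by rewrite e1.
  move: h1 h2; rewrite -e1; case: ifP => _; first exact: eq_angle_trans.
  case: ifP => _; first exact: eq_angle_trans.
  by move=> [a1 a2] [b1 b2]; split; [exact: eq_angle_trans a1 b1|
                                     exact: eq_angle_trans a2 b2].
Qed.

Canonical same_vector_rel (R : realType) (l : R) : equiv_rel 'rV[R]_3 :=
  EquivRelPack (same_vector_equiv l).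

Definition SS (R : realType) (l : R) : Type :=
  {eq_quot (@same_vector_rel R l)}%qT.

HB.instance Definition _ (R : realType) (l : R) := Choice.on (SS l).

Definition uvec (R : realType) (l : R) (p : 'rV[R]_3) : SS l :=
  \pi_(SS l)%qT p.

HB.instance Definition _ (R : realType) (l : R) :=
  isPointed.Build (SS l) (uvec l 0).

Definition in_strip (R : realType) (l : R) (p : 'rV[R]_3) : bool :=
  0 <= co0 p <= l.

Definition SSopen (R : realType) (l : R) : set (set (SS l)) :=
  [set U | exists2 O : set 'rV[R]_3, open O &
     forall p, in_strip l p -> (U (uvec l p) <-> O p)].

Definition SSborel (R : realType) (l : R) :
    measurableType (sigma_display (@SSopen R l)) :=
  g_sigma_algebraType (@SSopen R l).

Definition latitude (R : realType) (l : R) (z : SS l) : R :=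
  clamp l (co0 (repr z)).

Definition integral_of_motion (R : realType) (l : R) (g : R -> R) (m : R)
    (z : SS l) : R :=
  m * g (latitude z) * sin (co1 (repr z)) - prim g (latitude z).

(** Charts *)

(* Polar: the coordinates (t, phi, theta) away from the poles.
   North: (x, y, chi) with (x, y) = t (cos theta, sin theta) and chi the angle
   from d/dx; South: the same with l - t in place of t and - theta in place of
   theta, which preserves the orientation, so that phi becomes phi + pi.  In all
   charts the angles are real numbers: the charts are local parametrisations
   whose domains cover SS and which are injective modulo 2 pi. *)
Variant chart := Polar | North | South.

Definition chart_domain (R : realType) (l : R) (i : chart) : set 'rV[R]_3 :=
  match i with
  | Polar => [set p | 0 < co0 p < l]
  | _ => [set q | co0 q ^+ 2 + co1 q ^+ 2 < l ^+ 2]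
  end.

Definition from_polar (R : realType) (l : R) (i : chart) (p : 'rV[R]_3) :
    'rV[R]_3 :=
  let t := co0 p in let phi := co1 p in let theta := co2 p in
  match i with
  | Polar => p
  | North => vec3 (t * cos theta) (t * sin theta) (phi + theta)
  | South => vec3 ((l - t) * cos (- theta)) ((l - t) * sin (- theta))
                  (phi + pi - theta)
  end.

Definition coordinates (R : realType) (l : R) (i : chart) (z : SS l) :
    set 'rV[R]_3 :=
  [set q | chart_domain l i q /\
     exists p, [/\ in_strip l p, z = uvec l p & q = from_polar l i p]].

Definition chart_at (R : realType) (l : R) (z : SS l) : chart :=
  if latitude z == 0 then North else if latitude z == l then South else Polar.

(** Differential forms *)

Fixpoint iter_derive (R : realType) (f : 'rV[R]_3 -> R) (vs : seq 'rV[R]_3) :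
    'rV[R]_3 -> R :=
  if vs is v :: vs' then fun p => 'D_v (iter_derive f vs') p else f.

Definition smooth_on (R : realType) (D : set 'rV[R]_3) (f : 'rV[R]_3 -> R) :=
  forall vs p, D p -> {for p, continuous (iter_derive f vs)} /\
                      forall v, derivable (iter_derive f vs) p v.

Definition form1 (R : realType) : Type := chart -> 'rV[R]_3 -> 'rV[R]_3 -> R.

(* The expressions of a smooth 1-form on SS: those in North and South pull back
   to the one in Polar under the changes of coordinates. *)
Definition smooth_form1 (R : realType) (l : R) (a : form1 R) : Prop :=
  [/\ (forall i p, chart_domain l i p -> scalar (a i p)),
      (forall i v, smooth_on (chart_domain l i) (fun p => a i p v)),
      (forall i p v, chart_domain l Polar p ->
         a Polar p v = a i (from_polar l i p) ('D_v (from_polar l i) p)) &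
      (forall i q v, i <> Polar -> chart_domain l i q ->
         a i (q + vec3 0 0 (2 * pi)) v = a i q v)].

(* u and v are extended to constant vector fields. *)
Definition ext_deriv (R : realType) (a : 'rV[R]_3 -> 'rV[R]_3 -> R)
    (p u v : 'rV[R]_3) : R :=
  'D_u (fun q => a q v) p - 'D_v (fun q => a q u) p.

Definition metric (R : realType) (g : R -> R) (t : R) (v w : R * R) : R :=
  v.1 * w.1 + g t ^+ 2 * (v.2 * w.2).

Definition unit_vector (R : realType) (g : R -> R) (p : 'rV[R]_3) : R * R :=
  (cos (co1 p), sin (co1 p) / g (co0 p)).

Definition lambda_form (R : realType) (g : R -> R) (p xi : 'rV[R]_3) : R :=
  metric g (co0 p) (unit_vector g p) (co0 xi, co2 xi).

Definition area_form (R : realType) (g : R -> R) (p u v : 'rV[R]_3) : R :=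
  g (co0 p) * (co0 u * co2 v - co2 u * co0 v).

Definition omega (R : realType) (g : R -> R) (m : R) (p u v : 'rV[R]_3) : R :=
  m * ext_deriv (lambda_form g) p u v - area_form g p u v.

(* It is enough to compare two smooth 2-forms on the dense domain of Polar. *)
Definition primitive_of_omega (R : realType) (l : R) (g : R -> R) (m : R)
    (a : form1 R) : Prop :=
  smooth_form1 l a /\
  forall p u v, chart_domain l Polar p ->
    ext_deriv (a Polar) p u v = omega g m p u v.

(** Vector fields *)

(* The value at z is given in the chart [chart_at z], so that North and South
   are only used at q = (0, 0, chi). *)
Definition vfield (R : realType) : Type := chart -> 'rV[R]_3 -> 'rV[R]_3.

(* The phi-component is the one for which the velocity (cos phi, sin phi / g)
   satisfies the geodesic equation, see [geodesic_equation] below; geodesics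
   through a pole are meridians. *)
Definition geodesic_field (R : realType) (g : R -> R) : vfield R := fun i q =>
  match i with
  | Polar => vec3 (cos (co1 q)) (- derive1 g (co0 q) * sin (co1 q) / g (co0 q))
                  (sin (co1 q) / g (co0 q))
  | _ => vec3 (cos (co2 q)) (sin (co2 q)) 0
  end.

Lemma geodesic_equation (R : realType) (g t phi : R -> R) (s : R) :
  let X := geodesic_field g Polar (vec3 (t s) (phi s) 0) in
  let vt := fun u => cos (phi u) in
  let vtheta := fun u => sin (phi u) / g (t u) in
  derivable g (t s) 1 -> g (t s) != 0 ->
  is_derive s 1 t (co0 X) -> is_derive s 1 phi (co1 X) ->
  is_derive s 1 vt (g (t s) * derive1 g (t s) * vtheta s ^+ 2) /\
  is_derive s 1 vtheta
    (- 2 * (derive1 g (t s) / g (t s)) * vt s * vtheta s).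
Proof.
rewrite /= !mxE /= => dg g0 dt dphi.
have dgt : is_derive (t s) 1 g (derive1 g (t s)).
  by rewrite derive1E; exact: DeriveDef.
have dgts := is_derive1_comp dgt dt.
have dsin := is_derive1_comp (is_derive_sin (phi s)) dphi.
have dcos := is_derive1_comp (is_derive_cos (phi s)) dphi.
split.
  apply: is_derive_eq dcos _.
  by field.
have dinv : is_derive s 1 (fun u => (g (t u))^-1)
    (- (g (t s)) ^- 2 *: (derive1 g (t s) * cos (phi s))).
  have [dgt' egt'] := dgts.
  apply: DeriveDef; first exact: (@derivableV R R (g \o t) s 1 g0 dgt').
  by rewrite (@deriveV R R (g \o t) s 1 g0 dgt') egt'.
by apply: is_derive_eq (is_deriveM dsin dinv) _; rewrite /GRing.scale /=; field.
Qed.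

Definition fibre_rotation (R : realType) : vfield R := fun i _ =>
  match i with
  | Polar => vec3 0 1 0
  | _ => vec3 0 0 1
  end.

Definition magnetic_field (R : realType) (g : R -> R) (m : R) : vfield R :=
  fun i q => m *: geodesic_field g i q + @fibre_rotation R i q.

(* The function z |-> a_z (X_z); the choice of the coordinates of z in the chart
   [chart_at z] is immaterial when a is a smooth 1-form on SS. *)
Definition contract_form (R : realType) (l : R) (a : form1 R) (X : vfield R)
    (z : SS l) : R :=
  let i := chart_at z in
  let q := get (coordinates i z) in
  a i q (X i q).

Definition integral_curve (R : realType) (l : R) (X : vfield R)
    (c : R -> SS l) : Prop :=
  forall s, let i := chart_at (c s) in
  exists q : R -> 'rV[R]_3,
    (\forall u \near s, coordinates i (c u) (q u)) /\
    is_derive s 1 q (X i (q s)).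

Definition periodic_orbit (R : realType) (l : R) (X : vfield R)
    (c : R -> SS l) (T : R) : Prop :=
  [/\ 0 < T, integral_curve X c & forall s, c (s + T) = c s].

Definition flow (R : realType) (l : R) (X : vfield R)
    (Phi : R -> SS l -> SS l) : Prop :=
  [/\ (forall z, Phi 0 z = z),
      (forall z, integral_curve X (fun s => Phi s z)) &
      (forall s U, SSopen U -> SSopen (Phi s @^-1` U))].

(** Invariant measures and their action *)

Definition invariant_measure (R : realType) (l : R) (X : vfield R)
    (zeta : probability (SSborel l) R) : Prop :=
  forall Phi, @flow R l X Phi -> forall s (A : set (SSborel l)),
    measurable A -> zeta (Phi s @^-1` A) = zeta A.

(* The image of the normalised Lebesgue measure on [0, T] under c. *)
Definition orbit_measure (R : realType) (l : R) (c : R -> SS l) (T : R)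
    (zeta : probability (SSborel l) R) : Prop :=
  forall A : set (SSborel l), measurable A ->
    zeta A = ((T^-1)%:E * lebesgue_measure (`[0%R, T] `&` c @^-1` A))%E.

Definition supp (R : realType) (l : R) (zeta : probability (SSborel l) R) :
    set (SS l) :=
  [set z | forall U : set (SS l), SSopen U -> U z -> (0 < zeta U)%E].

(* For an invariant zeta this set has exactly one element. *)
Definition action_values (R : realType) (l : R) (g : R -> R) (m : R)
    (zeta : probability (SSborel l) R) : set R :=
  [set \int[zeta]_z contract_form a (magnetic_field g m) z
    | a in primitive_of_omega l g m].

Definition magnetic_action (R : realType) (l : R) (g : R -> R) (m : R)
    (zeta : probability (SSborel l) R) : R :=
  get (action_values g m zeta).

(* The unit velocity vectors of the curve s |-> (t s, theta s), which is
   supposed to stay away from the poles and to have unit speed. *)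
Definition velocity_lift (R : realType) (l : R) (g : R -> R)
    (t theta : R -> R) : set (SS l) :=
  [set z | exists s phi, [/\ z = uvec l (vec3 (t s) phi (theta s)),
     derive1 t s = cos phi & derive1 theta s = sin phi / g (t s)]].
Arguments velocity_lift {R} l g t theta.

(* Main.v *)
(* On the latitude t0 the magnetic field is w d/dtheta with w = 1 / g'(t0), so
   the orbit is explicit.  Let J(t) be the integral of a primitive a over the
   loop theta at latitude t and angle phi0.  Since da = omega,
   J'(t) = T w (m g' sin phi0 - g), while the same integral over the loop phi
   does not depend on t.  Both loops shrink to the fibre over a pole, with equal
   orientations at t = 0 and opposite ones at t = l; this fixes the integral over
   the fibre, and J(t) = T w (m g(t) sin phi0 - prim g t).  Hence every primitive
   gives the same action.

   A primitive is m lambda + dphi - Gamma dtheta.  It extends smoothly over the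
   poles because g, with vanishing even derivatives there, is t h(t) with h an
   even function of the polar radius; smoothness of such radial functions follows
   from iterating Hadamard's lemma.

   Invariance needs the uniqueness of the integral curves through the orbit: the
   function (t - t0)^2 + 2 (1 - eps sin phi) vanishes exactly on the orbit and
   satisfies a Gronwall inequality near it, so the times at which a curve is on
   the orbit form an open and closed set.

   For K_m > 0, the sign of m g' - g (resp. m g' + g) on one side of t0 shows that
   m g - Gamma (resp. - m g - Gamma) is monotone up to a pole, where its value is
   1 (resp. -1). *)
Require Import Defs.
From HB Require Import structures.
From mathcomp Require Import all_boot all_order all_algebra generic_quotient.
From mathcomp Require Import all_classical all_reals all_analysis.
From mathcomp Require Import measurable_realfun ring lra.
Set Implicit Arguments.
Unset Strict Implicit.
Unset Printing Implicit Defensive.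
Import Order.TTheory GRing.Theory Num.Theory.
Import numFieldNormedType.Exports.
Local Open Scope classical_set_scope.
Local Open Scope ring_scope.

(** * Calculus on the line *)

(** The value [antiderivative g l = 2] enters as Gamma(l) = 1 = - Gamma(0). With it dphi - Gamma
    dtheta becomes d(phi + theta) at t = 0 and d(phi - theta) at t = l, the differentials of the
    fibre angles there, and it also fixes the fibre integral as exactly w T. Dividing by T, the
    action is w (m g eps - Gamma) with eps the sign of g'(t0), that is, w times the integral of
    motion on the orbit; this is why the two differ by the factor g'(t0). No integration over
    surfaces is used: Stokes on an annulus becomes the derivative in t of a one-variable integral,
    and the passage to a pole becomes a limit computed in a cap chart, where the loop degenerates to
    a loop in the fibre. The representative [repr z] need not depend continuously on z. Arguments
    about a curve in SS therefore use local coordinates along the curve, or functions such as the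
    latitude, sin phi and the cosine of a difference of longitudes, which do not see the choice of
    angles. *)

Lemma is_derive_continuous (R : realType) (f : R -> R) (x d : R) :
  is_derive x 1 f d -> {for x, continuous f}.
Proof.
move=> [df _]; apply: differentiable_continuous.
exact/derivable1_diffP.
Qed.

Lemma is_derive_mulr (R : realType) (c x : R) : is_derive x 1 (fun u : R => u * c) c.
Proof.
apply: is_derive_eq (is_deriveM (is_derive_id x 1) (is_derive_cst c x 1)) _.
by rewrite scaler0 add0r /GRing.scale /= mulr1.
Qed.

Lemma is_derive_mull (R : realType) (c x : R) : is_derive x 1 (fun u : R => c * u) c.
Proof.
apply: is_derive_eq (is_deriveM (is_derive_cst c x 1) (is_derive_id x 1)) _.
by rewrite scaler0 addr0 /GRing.scale /= mulr1.
Qed.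

Lemma is_derive_csub (R : realType) (c x : R) : is_derive x 1 (fun u : R => c - u) (- 1).
Proof.
apply: is_derive_eq (is_deriveB (is_derive_cst c x 1) (is_derive_id x 1)) _.
by rewrite sub0r.
Qed.

Lemma is_derive_comp (R : realType) (f g : R -> R) (x a b : R) :
  is_derive (g x) 1 f a -> is_derive x 1 g b ->
  is_derive x 1 (fun u => f (g u)) (a * b).
Proof. exact: is_derive1_comp. Qed.

Lemma is_derive_mul (R : realType) (V : normedModType R) (f g : V -> R) (x v : V)
    (a b : R) :
  is_derive x v f a -> is_derive x v g b ->
  is_derive x v (fun u => f u * g u) (a * g x + f x * b).
Proof.
move=> df dg; apply: is_derive_eq (is_deriveM df dg) _.
by rewrite /GRing.scale /= addrC [g x * a]mulrC.
Qed.

Lemma is_derive_cmul (R : realType) (V : normedModType R) (c : R) (f : V -> R)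
    (x v : V) (a : R) :
  is_derive x v f a -> is_derive x v (fun u => c * f u) (c * a).
Proof.
move=> df; apply: is_derive_eq (is_derive_mul (is_derive_cst c x v) df) _.
by rewrite mul0r add0r.
Qed.

Lemma is_derive_add (R : realType) (V : normedModType R) (f g : V -> R) (x v : V)
    (a b : R) :
  is_derive x v f a -> is_derive x v g b ->
  is_derive x v (fun u => f u + g u) (a + b).
Proof. by move=> df dg; exact: is_deriveD. Qed.

Lemma is_derive_sub (R : realType) (V : normedModType R) (f g : V -> R) (x v : V)
    (a b : R) :
  is_derive x v f a -> is_derive x v g b ->
  is_derive x v (fun u => f u - g u) (a - b).
Proof. by move=> df dg; exact: is_deriveB. Qed.

Lemma is_derive0_constant_oo (R : realType) (f : R -> R) (a b : R) :
  (forall x, a < x < b -> is_derive x 1 f 0) ->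
  forall x y, a < x < b -> a < y < b -> f x = f y.
Proof.
move=> df x y; wlog xy : x y / x < y => [wl hx hy|/andP[ax xb] /andP[ay yb]].
  by have [/wl->//|/wl<-//|->//] := ltgtP x y.
have [||c _ ] := @MVT _ f (fun=> 0) x y xy.
- move=> z /[!in_itv]/= /andP[xz zy]; apply: df.
  by rewrite (lt_trans ax xz) (lt_trans zy yb).
- apply: continuous_in_subspaceT => z /[!inE]/= /[!in_itv]/= /andP[xz zy].
  apply: is_derive_continuous; apply: df.
  by rewrite (lt_le_trans ax xz) (le_lt_trans zy yb).
by rewrite mul0r => /eqP; rewrite subr_eq0 => /eqP.
Qed.

(** * Integrals depending on a parameter *)

Definition joint_continuous (R : realType) (f : R -> R -> R) (t s : R) : Prop :=
  {for (t, s), continuous (fun p : R * R => f p.1 p.2)}.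

Lemma joint_continuousP (R : realType) (f : R -> R -> R) (t s : R) :
  joint_continuous f t s <-> (fun p : R * R => f p.1 p.2) @ (t, s) --> f t s.
Proof. by []. Qed.

Lemma joint_continuous_slice (R : realType) (f : R -> R -> R) (t s : R) :
  joint_continuous f t s -> {for s, continuous (f t)}.
Proof.
move=> cf; have cp : (fun s => (t, s)) @ s --> (t, s).
  by apply: (cvg_pair (F := nbhs s) (cvg_cst _) cvg_id).
exact: (@continuous_comp _ _ _ (fun s => (t, s))
  (fun p : R * R => f p.1 p.2) s cp cf).
Qed.

(** Tube argument: near each (t, s) the function is bounded by [|f t s| + 1], and compactness of K
    makes the neighbourhood of t uniform in s. The bound M is carried as a second parameter tending
    to infinity, so that near covering makes it uniform at the same time. The result supplies the
    dominating constant for the two parameter-integral lemmas. *)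
Lemma joint_continuous_locally_bounded (R : realType) (f : R -> R -> R) (K : set R)
    (t : R) :
  compact K -> (forall s, K s -> joint_continuous f t s) ->
  exists M, \forall u \near t, forall s, K s -> `|f u s| <= M.
Proof.
move=> /compact_near_coveringP cK jf.
have := cK (R * R)%type (filter_prod (nbhs t) (pinfty_nbhs R))
  (fun i s => `|f i.1 s| <= i.2) _.
case=> [s Ks|[A B] /= [hA [M [Mr hB]]] AB].
  have /cvgrPdist_lt/(_ 1 ltr01) := (joint_continuousP _ _ _).1 (jf s Ks).
  case=> [[U V] [/= hU hV] UV].
  exists (V, (U `*` [set M | `|f t s| + 1 <= M])) => /=.
    split=> //; exists (U, [set M | `|f t s| + 1 <= M]) => //; split=> //=; exists (`|f t s| + 1).
    by split; [exact: num_real|move=> x /ltW].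
  move=> [s' [u M]] [/= Vs' [Uu hM]]; apply: le_trans hM.
  have /= h := UV (u, s') (conj Uu Vs').
  rewrite -lerBlDl; apply: le_trans (ltW h).
  by rewrite distrC; exact: lerB_dist.
exists (M + 1); apply: filterS hA => u Au s Ks.
by apply: (AB (u, M + 1)) => //; split => //=; apply: hB; rewrite ltrDl.
Qed.

Lemma continuous_integrable_itv (R : realType) (f : R -> R) (a b : R) :
  (forall s, a <= s <= b -> {for s, continuous f}) ->
  lebesgue_measure.-integrable `[a, b] (EFin \o f).
Proof.
move=> cf; apply: continuous_compact_integrable; first exact: segment_compact.
apply: continuous_in_subspaceT => s /[!inE]/= /[!in_itv]/=; exact: cf.
Qed.

Lemma continuous_integral (R : realType) (f : R -> R -> R) (a b t : R) :
  (\forall u \near t, forall s, a <= s <= b -> joint_continuous f u s) ->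
  {for t, continuous (fun u => \int[lebesgue_measure]_(s in `[a, b]) f u s)}.
Proof.
move=> jf.
have [M fM] : exists M, \forall u \near t, forall s, s \in `[a, b] -> `|f u s| <= M.
  have [s|M hM] := @joint_continuous_locally_bounded _ f `[a, b] t (@segment_compact _ _ _).
    by rewrite /= in_itv/= => hs; apply: (nbhs_singleton jf).
  by exists M.
have [e /= e0 he] := (nbhs_normP _ _).1 (filterI jf fM).
have inI u : `]t - e, t + e[%classic u ->
    (forall s, a <= s <= b -> joint_continuous f u s) /\
    (forall s, s \in `[a, b] -> `|f u s| <= M).
  rewrite /= in_itv/= => hu; apply: he => /=.
  by rewrite ltr_distlC.
apply: (@continuity_under_integral R _ _ lebesgue_measure f `[a, b] _ (t - e)
  (t + e) _ _ (fun=> M)) => //.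
- move=> u /inI[h _]; apply: continuous_integrable_itv => s hs.
  exact/joint_continuous_slice/h.
- apply/aeW => s /=; rewrite in_itv/= => hs u; rewrite inE => /inI[/(_ _ hs) h _].
  have cp : (fun u => (u, s)) @ u --> (u, s).
    by apply: (cvg_pair (F := nbhs u) cvg_id (cvg_cst _)).
  exact: (@continuous_comp _ _ _ (fun u => (u, s))
    (fun p : R * R => f p.1 p.2) u cp h).
- by apply: continuous_integrable_itv => s _; exact: cvg_cst.
- by move=> u /inI[_ h]; apply/aeW => s /= /h.
- by rewrite inE /= in_itv/= ltrBlDr ltrDl e0.
Qed.

Lemma is_derive_integral (R : realType) (f f' : R -> R -> R) (a b t : R) :
  (\forall u \near t, forall s, a <= s <= b ->
     [/\ joint_continuous f u s, joint_continuous f' u s & is_derive u 1 (f ^~ s) (f' u s)]) ->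
  is_derive t 1 (fun u => \int[lebesgue_measure]_(s in `[a, b]) f u s)
    (\int[lebesgue_measure]_(s in `[a, b]) f' t s).
Proof.
move=> jf.
have [M fM] : exists M, \forall u \near t, forall s, s \in `[a, b] -> `|f' u s| <= M.
  have [s|M hM] := @joint_continuous_locally_bounded _ f' `[a, b] t (@segment_compact _ _ _).
    by rewrite /= in_itv/= => hs; have [] := nbhs_singleton jf s hs.
  by exists M.
have [e /= e0 he] := (nbhs_normP _ _).1 (filterI jf fM).
have inI u : `]t - e, t + e[%classic u ->
    (forall s, a <= s <= b ->
     [/\ joint_continuous f u s, joint_continuous f' u s & is_derive u 1 (f ^~ s) (f' u s)]) /\
    (forall s, s \in `[a, b] -> `|f' u s| <= M).
  rewrite /= in_itv/= => hu; apply: he => /=.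
  by rewrite ltr_distlC.
have It : `]t - e, t + e[%classic t by rewrite /= in_itv/= ltrBlDr ltrDl e0.
have d1 u s : `]t - e, t + e[%classic u -> `[a, b]%classic s ->
    partial1of2 f u s = f' u s.
  move=> /inI[h _] /=; rewrite in_itv/= => /h[_ _ h'].
  by rewrite partial1of2E; exact: derive_val.
have [intf derf intG ub] : [/\
  (forall x, `]t - e, t + e[%classic x ->
     lebesgue_measure.-integrable `[a, b] (EFin \o f x)),
  (forall x y, `]t - e, t + e[%classic x -> `[a, b]%classic y ->
     derivable (f ^~ y) x 1),
  lebesgue_measure.-integrable `[a, b] (EFin \o (fun _ : R => `|M|)) &
  (forall x y, `]t - e, t + e[%classic x -> `[a, b]%classic y ->
     `|partial1of2 f x y| <= `|M|)].
  split.
  - move=> u /inI[h _]; apply: continuous_integrable_itv => s hs.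
    by have [h1 _ _] := h s hs; exact: joint_continuous_slice h1.
  - by move=> u s /inI[h _] /=; rewrite in_itv/= => /h[_ _ []].
  - by apply: continuous_integrable_itv => s _; exact: cvg_cst.
  - move=> u s hu hs; rewrite d1//; apply: le_trans (ler_norm M).
    by have [_] := inI u hu; apply.
have M0 : forall y : R, 0 <= (fun _ : R => `|M|) y by [].
have mab : measurable (`[a, b]%classic : set R) by [].
apply: DeriveDef.
  exact: (@derivable_under_integral R _ _ lebesgue_measure f _ mab t _ _ It intf derf _ M0 intG ub).
rewrite -derive1E.
rewrite (@differentiation_under_integral R _ _ lebesgue_measure f _ mab t _ _ It intf derf _ M0 intG ub).
by apply: eq_Rintegral => s; rewrite inE => hs; exact: d1.
Qed.

Lemma Rintegral_derive (R : realType) (f F : R -> R) (a b : R) : a < b ->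
  (forall x, a <= x <= b -> is_derive x 1 F (f x)) ->
  (forall x, a <= x <= b -> {for x, continuous f}) ->
  \int[lebesgue_measure]_(x in `[a, b]) f x = F b - F a.
Proof.
move=> ab dF cf; rewrite /Rintegral (@continuous_FTC2 _ f F) //.
- apply: continuous_in_subspaceT => s /[!inE]/= /[!in_itv]/=; exact: cf.
- have cF x : a <= x <= b -> {for x, continuous F}.
    by move=> /dF; exact: is_derive_continuous.
  split.
  + by move=> x /[!in_itv]/= /andP[ax xb]; have [] := dF x; rewrite ?(ltW ax) ?(ltW xb).
  + by apply: cvg_at_right_filter; apply: cF; rewrite lexx ltW.
  + by apply: cvg_at_left_filter; apply: cF; rewrite lexx ltW.
- move=> x /[!in_itv]/= /andP[ax xb]; rewrite derive1E; apply: (@derive_val _ _ _ _ _ _ _ _).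
  by apply: dF; rewrite ?(ltW ax) ?(ltW xb).
Qed.

Lemma Rintegral_constant (R : realType) (c a b : R) : a < b ->
  \int[lebesgue_measure]_(x in `[a, b]) c = c * (b - a).
Proof.
move=> ab; have h := @Rintegral_derive _ (fun=> c) (fun x => c * x) a b ab.
rewrite mulrBr; apply: h => x _; first exact: is_derive_mull.
exact: cst_continuous.
Qed.

(** Serves to compare the two orientations of the fibre over the pole t = l. *)
Lemma Rintegral_reflect (R : realType) (f : R -> R) (T : R) : 0 <= T ->
  continuous f ->
  \int[lebesgue_measure]_(s in `[0, T]) f (T - s) =
  \int[lebesgue_measure]_(s in `[0, T]) f s.
Proof.
move=> T0 cf; have dF (x : R) : is_derive x 1 (fun s : R => T - s) (- 1).
  exact: is_derive_csub.
have F' : derive1 (fun s : R => T - s) = cst (- 1).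
  by apply/funext => x; rewrite derive1E derive_val.
have := @integration_by_substitution_decreasing _ (fun s : R => T - s) f 0 T.
rewrite /Rintegral subr0 subrr => -> //.
- congr fine; apply: eq_integral => s _.
  by rewrite F' /= fctE /= opprK mulr1.
- by move=> x y _ _ xy; rewrite ltrD2l ltrN2.
- by rewrite F' => x _; exact: cvg_cst.
- by rewrite F'; exact: is_cvg_cst.
- by rewrite F'; exact: is_cvg_cst.
- split.
  + by move=> x _; have [] := dF x.
  + by apply: cvg_at_right_filter; exact: is_derive_continuous (dF 0).
  + by apply: cvg_at_left_filter; exact: is_derive_continuous (dF T).
- by apply: continuous_subspaceT.
Qed.

(** * Smooth functions on the line, Hadamard quotients, antiderivatives *)

Definition smooth (R : realType) (f : R -> R) : Prop :=
  forall n x, derivable (derive1n n f) x 1.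

Lemma smooth_is_derive (R : realType) (f : R -> R) n (x : R) :
  smooth f -> is_derive x 1 (derive1n n f) ((derive1n n.+1 f) x).
Proof. by move=> /(_ n x) df; rewrite derive1nS derive1E; exact: derivableP. Qed.

Lemma smooth_is_derive1 (R : realType) (f : R -> R) (x : R) :
  smooth f -> is_derive x 1 f ((derive1 f) x).
Proof. by move=> /(@smooth_is_derive _ _ 0 x); rewrite derive1n1. Qed.

Lemma smooth_continuous (R : realType) (f : R -> R) n :
  smooth f -> continuous (derive1n n f).
Proof. move=> sf x; exact: is_derive_continuous (smooth_is_derive n x sf). Qed.

Lemma derive1n_seq (R : realType) (F : nat -> R -> R) n :
  (forall n (x : R), is_derive x 1 (F n) (F n.+1 x)) -> derive1n n (F 0%N) = F n.
Proof.
move=> dF; elim: n => // n IHn; rewrite derive1nS IHn.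
by apply/funext => x; rewrite derive1E; exact: derive_val.
Qed.

Lemma smooth_seq (R : realType) (F : nat -> R -> R) :
  (forall n (x : R), is_derive x 1 (F n) (F n.+1 x)) -> smooth (F 0%N).
Proof. by move=> dF n x; rewrite derive1n_seq//; have [] := dF n x. Qed.

Lemma smooth_derive1 (R : realType) (f : R -> R) : smooth f -> smooth (derive1 f).
Proof. by move=> sf n x; rewrite -derive1Sn; exact: sf. Qed.

(** Differentiating in t replaces f by f' and brings down one factor u. The exponent n makes the
    family closed under differentiation, so smoothness follows by induction. *)
Definition moment (R : realType) (n : nat) (f : R -> R) (t : R) : R :=
  \int[lebesgue_measure]_(u in `[0, 1]) (u ^+ n * f (u * t)).

Lemma joint_continuous_moment (R : realType) (f : R -> R) n (t s : R) :
  continuous f -> joint_continuous (fun t u : R => u ^+ n * f (u * t)) t s.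
Proof.
move=> cf; apply/joint_continuousP.
have c1 : (fun p : R * R => p.1) @ (t, s) --> t by exact: cvg_fst.
have c2 : (fun p : R * R => p.2) @ (t, s) --> s by exact: cvg_snd.
have c3 : (fun p : R * R => p.2 * p.1) @ (t, s) --> s * t by exact: cvgM c2 c1.
have c4 := cvg_comp _ _ c2 (@exprn_continuous R n s).
have c5 := cvg_comp _ _ c3 (cf (s * t)).
exact: cvgM c4 c5.
Qed.

Lemma is_derive_moment (R : realType) (f : R -> R) n (t : R) :
  smooth f -> is_derive t 1 (moment n f) (moment n.+1 (derive1 f) t).
Proof.
move=> sf; apply: (@is_derive_integral _ (fun t u : R => u ^+ n * f (u * t))
  (fun t u : R => u ^+ n.+1 * (derive1 f) (u * t))).
apply: (@filterE _ (nbhs t)) => x s _; split.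
- by apply: joint_continuous_moment; exact: (smooth_continuous (n := 0) sf).
- by apply: joint_continuous_moment; rewrite -derive1n1; exact: smooth_continuous.
- have dl : is_derive x 1 (fun t : R => s * t) s.
    exact: is_derive_mull.
  have dc := is_derive_comp (smooth_is_derive1 (s * x) sf) dl.
  apply: is_derive_eq (is_derive_cmul (s ^+ n) dc) _.
  by rewrite exprSr; ring.
Qed.

Lemma moment_derive1n (R : realType) (f : R -> R) n k :
  smooth f -> derive1n k (moment n f) = moment (n + k) (derive1n k f).
Proof.
move=> sf; rewrite -[in LHS](addn0 n) -[X in moment _ X](derive1n0 f).
apply: (@derive1n_seq _ (fun k => moment (n + k) (derive1n k f))) => i x.
rewrite addnS derive1nS; apply: is_derive_moment => j y.
by rewrite /derive1n -iterD; exact: (sf (j + i)%N).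
Qed.

Lemma smooth_moment (R : realType) (f : R -> R) n : smooth f -> smooth (moment n f).
Proof.
move=> sf k x; rewrite moment_derive1n//.
have sfk : smooth (derive1n k f) by move=> j y; rewrite /derive1n -iterD; exact: (sf (j + k)%N).
by have [] := is_derive_moment (n + k) x sfk.
Qed.

Lemma moment_at0 (R : realType) (f : R -> R) n : f 0 = 0 -> moment n f 0 = 0.
Proof.
move=> f0; rewrite /moment (@eq_Rintegral _ _ _ _ _ (cst 0)); last first.
  by move=> x _; rewrite mulr0 f0 mulr0.
by rewrite Rintegral_cst// mul0r.
Qed.

(** The quotient (f t - f 0) / t, written as the integral of f'(u t) over u in [0, 1] so that it is
    defined, and smooth for smooth f, at t = 0 as well. *)
HB.lock Definition hadamard (R : realType) (f : R -> R) : R -> R :=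
  moment 0 (derive1 f).
Arguments hadamard {R}.

Lemma hadamardE (R : realType) (f : R -> R) (t : R) :
  smooth f -> f t = f 0 + t * hadamard f t.
Proof.
move=> sf; have dl (u : R) := is_derive_mulr t u.
have [->|t0] := eqVneq t 0; first by rewrite mul0r addr0.
have sf' := smooth_derive1 sf; have cf' := smooth_continuous (n := 0) sf'.
have cl (u : R) : {for u, continuous (fun u : R => derive1 f (u * t))}.
  apply: (@continuous_comp _ _ _ (fun u : R => u * t) (derive1 f)).
    exact: is_derive_continuous (dl u).
  exact: cf'.
have := @Rintegral_derive _ (fun u => t * derive1 f (u * t)) (fun u => f (u * t)) 0 1 ltr01.
rewrite mul1r mul0r => h.
rewrite hadamard.unlock /moment.
under eq_Rintegral do rewrite expr0 mul1r.
rewrite -RintegralZl//; last by apply: continuous_integrable_itv => s _; exact: cl.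
suff -> : \int[lebesgue_measure]_(x in `[0, 1]) (t * derive1 f (x * t)) = f t - f 0.
  by rewrite addrC subrK.
apply: h.
- move=> x _; have := @is_derive_comp _ _ ( *%R^~ t) x _ _ (smooth_is_derive1 (x * t) sf) (dl x).
  by rewrite mulrC.
- by move=> x _; apply: continuousM; [exact: cst_continuous|exact: cl].
Qed.

Lemma smooth_hadamard (R : realType) (f : R -> R) : smooth f -> smooth (hadamard f).
Proof. by rewrite hadamard.unlock => /smooth_derive1 sf; exact: smooth_moment. Qed.

Lemma hadamard0 (R : realType) (f : R -> R) : hadamard f 0 = derive1 f 0.
Proof.
rewrite hadamard.unlock /moment (@eq_Rintegral _ _ _ _ _ (fun=> derive1 f 0)).
  by rewrite Rintegral_constant// subr0 mulr1.
by move=> x _; rewrite mulr0 expr0 mul1r.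
Qed.

(* The function has the Taylor coefficients of an even (resp. odd) function
   at 0. *)
Definition even0 (R : realType) (f : R -> R) : Prop :=
  smooth f /\ forall k, derive1n k.*2.+1 f 0 = 0.
Definition odd0 (R : realType) (f : R -> R) : Prop :=
  smooth f /\ forall k, derive1n k.*2 f 0 = 0.

(** The n-th derivative of the quotient at 0 is the integral of u^n times the (n+1)-st derivative of
    f at 0. Orders shift by one, so taking the quotient exchanges the even and odd parities. *)
Lemma hadamard_derive1n0 (R : realType) (f : R -> R) n : smooth f ->
  derive1n n.+1 f 0 = 0 -> derive1n n (hadamard f) 0 = 0.
Proof.
move=> sf fn; rewrite hadamard.unlock moment_derive1n; last exact: smooth_derive1.
by rewrite moment_at0// -derive1Sn.
Qed.

Lemma even0_hadamard (R : realType) (f : R -> R) : odd0 f -> even0 (hadamard f).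
Proof.
move=> [sf f0]; split=> [|k]; first exact: smooth_hadamard.
by apply: hadamard_derive1n0 => //; rewrite -doubleS.
Qed.

Lemma odd0_hadamard (R : realType) (f : R -> R) : even0 f -> odd0 (hadamard f).
Proof.
move=> [sf f0]; split=> [|k]; first exact: smooth_hadamard.
exact: hadamard_derive1n0.
Qed.

Lemma odd0_derive1 (R : realType) (f : R -> R) : even0 f -> odd0 (derive1 f).
Proof.
move=> [sf f0]; split=> [|k]; first exact: smooth_derive1.
by rewrite -derive1Sn.
Qed.

Lemma odd0_at0 (R : realType) (f : R -> R) : odd0 f -> f 0 = 0.
Proof. by move=> [_ /(_ 0%N)]. Qed.

(** The substitution s = u t turns the integral of f from 0 to t into this product, which keeps its
    meaning for negative t. *)
HB.lock Definition antiderivative (R : realType) (f : R -> R) (t : R) : R :=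
  t * moment 0 f t.
Arguments antiderivative {R}.

Lemma antiderivative0 (R : realType) (f : R -> R) : antiderivative f 0 = 0.
Proof. by rewrite antiderivative.unlock mul0r. Qed.

(** The product rule gives the integral over [0, 1] of t u f'(u t) + f(u t), which is the
    u-derivative of u f(u t). *)
Lemma is_derive_antiderivative (R : realType) (f : R -> R) (t : R) :
  smooth f -> is_derive t 1 (antiderivative f) (f t).
Proof.
rewrite antiderivative.unlock => sf.
have h := is_deriveM (is_derive_id t 1) (is_derive_moment 0 t sf).
apply: is_derive_eq h _; rewrite /GRing.scale /= mulr1.
have cf := smooth_continuous (n := 0) sf.
have cf' := smooth_continuous (n := 0) (smooth_derive1 sf).
have dl (u : R) := is_derive_mulr t u.
have cm (n : nat) (g : R -> R) : continuous g -> forall s : R,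
    {for s, continuous (fun u : R => u ^+ n * g (u * t))}.
  by move=> cg s; have := joint_continuous_slice (@joint_continuous_moment _ g n t s cg).
rewrite /moment -RintegralZl//; last by apply: continuous_integrable_itv => s _; exact: cm.
rewrite -RintegralD//; last 2 first.
- apply: continuous_integrable_itv => s _; apply: continuousM; first exact: cst_continuous.
  exact: cm.
- by apply: continuous_integrable_itv => s _; exact: cm.
have := @Rintegral_derive _ (fun u => t * (u ^+ 1 * derive1 f (u * t)) + u ^+ 0 * f (u * t))
  (fun u => u * f (u * t)) 0 1 ltr01.
rewrite !mul1r mul0r subr0; apply.
- move=> x _; have h1 := @is_derive_comp _ _ ( *%R^~ t) x _ _ (smooth_is_derive1 (x * t) sf) (dl x).
  apply: is_derive_eq (is_derive_mul (is_derive_id x 1) h1) _; ring.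
- move=> x _; apply: continuousD; last exact: cm.
  by apply: continuousM; [exact: cst_continuous|exact: cm].
Qed.

Lemma antiderivative_derive1 (R : realType) (f : R -> R) :
  smooth f -> derive1 (antiderivative f) = f.
Proof.
move=> sf; apply/funext => t; rewrite derive1E.
exact: (@derive_val _ _ _ _ _ _ _ (is_derive_antiderivative t sf)).
Qed.

Lemma even0_antiderivative (R : realType) (f : R -> R) :
  odd0 f -> even0 (antiderivative f).
Proof.
move=> [sf f0]; split=> [[|n] x|k]; last by rewrite derive1Sn antiderivative_derive1.
- by have [] := is_derive_antiderivative x sf.
- by rewrite derive1Sn antiderivative_derive1.
Qed.

Lemma smooth_reflect (R : realType) (f : R -> R) (l : R) :
  smooth f -> smooth (fun u => f (l - u)) /\
  forall n u, derive1n n (fun u => f (l - u)) u = (-1) ^+ n * derive1n n f (l - u).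
Proof.
move=> sf.
have dF n (x : R) : is_derive x 1 (fun u => (-1) ^+ n * derive1n n f (l - u))
    ((-1) ^+ n.+1 * derive1n n.+1 f (l - x)).
  have dl : is_derive x 1 (fun u : R => l - u) (-1).
    exact: is_derive_csub.
  have h := @is_derive_comp _ _ (fun u : R => l - u) x _ _ (smooth_is_derive n (l - x) sf) dl.
  by apply: is_derive_eq (is_derive_cmul ((-1) ^+ n) h) _; rewrite exprS; ring.
have E : (fun u => (-1) ^+ 0 * derive1n 0 f (l - u)) = (fun u => f (l - u)).
  by apply/funext => u; rewrite expr0 mul1r.
split; first by have := smooth_seq dF; rewrite E.
by move=> n u; rewrite -E (derive1n_seq n dF).
Qed.

(** The image of Lebesgue measure under the translation agrees with it on the intervals ]a, b],
    which determine it. *)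
Lemma lebesgue_measure_shift (R : realType) (s : R) (B : set (measurableTypeR R)) :
  measurable B ->
  lebesgue_measure [set u | B (u + s)] = lebesgue_measure B.
Proof.
move=> mB.
have mf : measurable_fun [set: measurableTypeR R]
    ((fun u => u + s) : measurableTypeR R -> measurableTypeR R).
  apply: continuous_measurable_fun => x; apply: cvgD; first exact: cvg_id.
  exact: cvg_cst.
pose f : {mfun measurableTypeR R >-> measurableTypeR R} :=
  HB.pack ((fun u => u + s) : measurableTypeR R -> measurableTypeR R)
    (isMeasurableFun.Build _ _ _ _ _ mf).
rewrite (@lebesgue_measure_unique R (pushforward (@lebesgue_measure R) f) _ B mB) //.
move=> X [[a b] _ <-]; rewrite /pushforward /=.
have E : (fun u : R => u + s) @^-1` `]a, b]%classic = `]a - s, b - s]%classic.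
  by apply/seteqP; split=> u /=; rewrite !in_itv/= ltrBlDr lerBrDr.
rewrite [X in _ = lebesgue_measure X]E.
rewrite !lebesgue_measure_itv /= !lte_fin ltrD2r.
by case: ifP => // _; rewrite -!EFinB; congr EFin; ring.
Qed.

(** * Smooth functions of three variables *)

Lemma is_derive_line (R : realType) (f : 'rV[R]_3 -> R) (p v : 'rV[R]_3) (t d : R) :
  is_derive t 1 (fun x : R => f (x *: v + p)) d <-> is_derive (t *: v + p) v f d.
Proof.
have E : (fun h : R => h^-1 *: (((fun x : R => f (x *: v + p)) \o shift t) (h *: 1)
     - f (t *: v + p))) =
    (fun h : R => h^-1 *: ((f \o shift (t *: v + p)) (h *: v) - f (t *: v + p))).
  by apply/funext => h /=; rewrite [h%:A]mulr1 scalerDl addrA.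
by split=> -[dfp efp]; (split; [move: dfp|move: efp]); rewrite /derivable /derive E.
Qed.

Lemma is_derive_line0 (R : realType) (f : 'rV[R]_3 -> R) (p v : 'rV[R]_3) (d : R) :
  is_derive (0 : R) 1 (fun x : R => f (x *: v + p)) d -> is_derive p v f d.
Proof. by move=> /is_derive_line; rewrite scale0r add0r. Qed.

(** [smooth_on] concerns all iterated directional derivatives. If the derivatives of the generators
    are polynomials in the generators, the generated algebra is stable under differentiation, and
    every iterated derivative is again a continuous, differentiable member of it. *)
Inductive alg (R : realType) (B : ('rV[R]_3 -> R) -> Prop) : ('rV[R]_3 -> R) -> Prop :=
| alg_cst c : alg B (fun=> c)
| alg_gen f : B f -> alg B f
| alg_add f g : alg B f -> alg B g -> alg B (fun p => f p + g p)
| alg_mul f g : alg B f -> alg B g -> alg B (fun p => f p * g p).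

Definition derivation_closed (R : realType) (B C : ('rV[R]_3 -> R) -> Prop) :=
  forall f, B f -> continuous f /\
    forall v, exists2 f', C f' & forall p, is_derive p v f (f' p).

Lemma alg_derivation_closed (R : realType) (B : ('rV[R]_3 -> R) -> Prop) :
  derivation_closed B (alg B) -> derivation_closed (alg B) (alg B).
Proof.
move=> cB f; elim=> [c|{}f /cB//|{}f g af [cf df] ag [cg dg]|{}f g af [cf df] ag [cg dg]].
- split=> [|v]; first exact: cst_continuous.
  exists (fun=> 0); [exact: alg_cst|move=> p; exact: is_derive_cst].
- split=> [p|v]; first exact: cvgD (cf p) (cg p).
  have [f' af' {}df] := df v; have [g' ag' {}dg] := dg v.
  exists (fun p => f' p + g' p) => [|p]; first exact: alg_add.
  exact: is_deriveD (df p) (dg p).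
- split=> [p|v]; first exact: cvgM (cf p) (cg p).
  have [f' af' {}df] := df v; have [g' ag' {}dg] := dg v.
  exists (fun p => f p * g' p + g p * f' p) => [|p].
    by apply: alg_add; exact: alg_mul.
  exact: is_deriveM (df p) (dg p).
Qed.

Lemma alg_smooth_on (R : realType) (B : ('rV[R]_3 -> R) -> Prop) (D : set 'rV[R]_3) f :
  derivation_closed B (alg B) -> alg B f -> smooth_on D f.
Proof.
move=> /alg_derivation_closed cB af vs p _.
have [h ah ->] : exists2 h, alg B h & iter_derive f vs = h.
  elim: vs => [|v vs [h ah IH]] /=; first by exists f.
  have [_ /(_ v)[h' ah' dh]] := cB h ah.
  exists h' => //; apply/funext => q; rewrite IH.
  by have [] := dh q.
have [ch dh] := cB h ah; split=> [|v]; first exact: ch.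
by have [h' _ /(_ p)[]] := dh v.
Qed.

Definition axial_radius (R : realType) (p : 'rV[R]_3) : R :=
  Num.sqrt (p ord0 0 ^+ 2 + p ord0 1 ^+ 2).

Lemma coord_continuous3 (R : realType) (i : 'I_3) : continuous (fun p : 'rV[R]_3 => p ord0 i).
Proof. move=> p; exact: coord_continuous. Qed.

Lemma axial_radius_continuous (R : realType) : continuous (@axial_radius R).
Proof.
move=> p; apply: (@continuous_comp _ _ _ (fun p : 'rV[R]_3 => p ord0 0 ^+ 2 + p ord0 1 ^+ 2)
  (@Num.sqrt R)); last exact: sqrt_continuous.
have cc i := @coord_continuous3 R i p.
exact: cvgD (cvgM (cc 0) (cc 0)) (cvgM (cc 1) (cc 1)).
Qed.

Lemma is_derive_coord (R : realType) (i : 'I_3) (p v : 'rV[R]_3) (t : R) :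
  is_derive t 1 (fun x : R => (x *: v + p) ord0 i) (v ord0 i).
Proof.
have -> : (fun x : R => (x *: v + p) ord0 i) = (fun x => x * v ord0 i + p ord0 i).
  by apply/funext => x; rewrite !mxE.
apply: is_derive_eq (is_derive_add (is_derive_mulr (v ord0 i) t) (is_derive_cst (p ord0 i) t 1)) _.
by rewrite addr0.
Qed.

Lemma is_derive_fun_coord (R : realType) (F F' : R -> R) (i : 'I_3) (p v : 'rV[R]_3) :
  (forall x : R, is_derive x 1 F (F' x)) ->
  is_derive p v (fun p => F (p ord0 i)) (v ord0 i * F' (p ord0 i)).
Proof.
move=> dF; apply: is_derive_line0.
have h := @is_derive_comp _ F (fun x : R => (x *: v + p) ord0 i) 0 _ _ (dF _)
  (is_derive_coord i p v 0).
by apply: is_derive_eq h _; rewrite scale0r add0r mulrC.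
Qed.

(** Off the axis the gradient of H(r) is H'(r) / r times (x, y), and H'(r) / r is
    [hadamard (derive1 H)] because H' vanishes at 0. For even H this factor is even again, so the
    formula continues over the axis and stays within radial functions of the same kind. *)
Lemma is_derive_radial (R : realType) (H : R -> R) (p v : 'rV[R]_3) :
  even0 H ->
  is_derive p v (fun p => H (axial_radius p))
    ((p ord0 0 * v ord0 0 + p ord0 1 * v ord0 1) * hadamard (derive1 H) (axial_radius p)).
Proof.
move=> eH; have [sH _] := eH; have oH' := odd0_derive1 eH.
have sH' := smooth_derive1 sH.
pose S (q : 'rV[R]_3) := q ord0 0 ^+ 2 + q ord0 1 ^+ 2.
apply: is_derive_line0.
have [Sp0|Sp0] := eqVneq (S p) 0.
  move: (Sp0) => /eqP; rewrite /S paddr_eq0 ?sqr_ge0// !sqrf_eq0 => /andP[/eqP p0 /eqP p1].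
  have r0 : axial_radius p = 0 by rewrite /axial_radius -/(S p) Sp0 sqrtr0.
  rewrite p0 p1 !mul0r add0r mul0r.
  (* On the axis H(t) = H(0) + t^2 h(t) since H'(0) = 0, and r^2 = z^2 S(v) along the line. The
     difference quotient is therefore z S(v) h(r), which tends to 0. *)
  apply/is_derive1_caratheodory.
  exists (fun z : R => z * (S v * hadamard (hadamard H) (axial_radius (z *: v + p)))); split.
  - move=> z; rewrite subr0 scale0r add0r r0.
    have Hq (t : R) : H t = H 0 + t ^+ 2 * hadamard (hadamard H) t.
      rewrite (hadamardE t sH) [hadamard H t](hadamardE t (smooth_hadamard sH)).
      by rewrite (odd0_at0 (odd0_hadamard eH)); ring.
    rewrite [in LHS]Hq addrC addKr.
    have -> : axial_radius (z *: v + p) ^+ 2 = z ^+ 2 * S v.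
      rewrite sqr_sqrtr ?addr_ge0 ?sqr_ge0//.
      by rewrite !mxE p0 p1 /S; ring.
    ring.
  - have cl : {for (0 : R), continuous (fun z : R => z *: v + p)}.
      apply: cvgD; last exact: cvg_cst.
      by apply: cvgZr_tmp; exact: cvg_id.
    have cr : {for (0 : R), continuous (fun z : R => axial_radius (z *: v + p))}.
      by apply: (@continuous_comp _ _ _ (fun z : R => z *: v + p) (@axial_radius R)) => //;
        exact: axial_radius_continuous.
    have ch : {for (0 : R), continuous
        (fun z : R => hadamard (hadamard H) (axial_radius (z *: v + p)))}.
      apply: (@continuous_comp _ _ _ (fun z : R => axial_radius (z *: v + p))
        (hadamard (hadamard H))) => //.
      by apply: (smooth_continuous (n := 0)); do 2 apply: smooth_hadamard.
    apply: cvgM; first exact: cvg_id.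
    by apply: cvgM ch; exact: cvg_cst.
  - by rewrite mul0r.
have Sgt : 0 < S p by rewrite lt_def Sp0 addr_ge0 ?sqr_ge0.
have dS : is_derive (0 : R) 1 (fun x : R => S (x *: v + p)) (2 * (p ord0 0 * v ord0 0 + p ord0 1 * v ord0 1)).
  have h i := is_derive_mul (is_derive_coord i p v 0) (is_derive_coord i p v 0).
  apply: is_derive_eq (is_derive_add (h 0) (h 1)) _.
  by rewrite !scale0r !add0r; ring.
have dr : is_derive (0 : R) 1 (fun x : R => axial_radius (x *: v + p))
    ((2 * axial_radius p)^-1 * (2 * (p ord0 0 * v ord0 0 + p ord0 1 * v ord0 1))).
  apply: (@is_derive_comp _ (@Num.sqrt R) (fun x : R => S (x *: v + p))) dS.
  by rewrite scale0r add0r; exact: is_derive1_sqrt.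
have h := @is_derive_comp _ H _ _ _ _ (smooth_is_derive1 _ sH) dr.
apply: is_derive_eq h _; rewrite scale0r add0r.
rewrite (hadamardE (axial_radius p) sH') (odd0_at0 oH').
have r0 : axial_radius p != 0 by rewrite gt_eqF// sqrtr_gt0.
by field.
Qed.

Inductive generator (R : realType) : ('rV[R]_3 -> R) -> Prop :=
| gen_coord i : generator (fun p => p ord0 i)
| gen_sin i : generator (fun p => sin (p ord0 i))
| gen_cos i : generator (fun p => cos (p ord0 i))
| gen_fun F i : smooth F -> generator (fun p => F (p ord0 i))
| gen_radial H : even0 H -> generator (fun p => H (axial_radius p)).

Lemma generator_derivation_closed (R : realType) :
  derivation_closed (@generator R) (alg (@generator R)).
Proof.
move=> f; case=> [i|i|i|F i sF|H eH].
- split=> [p|v]; first exact: coord_continuous3.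
  exists (fun p => v ord0 i * 1) => [|p]; first exact: alg_cst.
  exact: (@is_derive_fun_coord _ id (fun=> 1)).
- split=> [p|v].
    apply: (@continuous_comp _ _ _ (fun p : 'rV[R]_3 => p ord0 i) (@sin R)).
      exact: coord_continuous3.
    exact: continuous_sin.
  exists (fun p => v ord0 i * cos (p ord0 i)) => [|p].
    by apply: alg_mul; [exact: alg_cst|exact/alg_gen/gen_cos].
  exact: is_derive_fun_coord.
- split=> [p|v].
    apply: (@continuous_comp _ _ _ (fun p : 'rV[R]_3 => p ord0 i) (@cos R)).
      exact: coord_continuous3.
    exact: continuous_cos.
  exists (fun p => v ord0 i * (-1 * sin (p ord0 i))) => [|p].
    apply: alg_mul; first exact: alg_cst.
    by apply: alg_mul; [exact: alg_cst|exact/alg_gen/gen_sin].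
  apply: (@is_derive_fun_coord _ cos (fun x => -1 * sin x)) => x.
  by rewrite mulN1r; exact: is_derive_cos.
- split=> [p|v].
    apply: (@continuous_comp _ _ _ (fun p : 'rV[R]_3 => p ord0 i) F).
      exact: coord_continuous3.
    exact: (smooth_continuous (n := 0)).
  exists (fun p => v ord0 i * derive1 F (p ord0 i)) => [|p].
    by apply: alg_mul; [exact: alg_cst|apply/alg_gen/gen_fun/smooth_derive1].
  by apply: is_derive_fun_coord => x; exact: smooth_is_derive1.
- split=> [p|v].
    apply: (@continuous_comp _ _ _ (@axial_radius R) H); first exact: axial_radius_continuous.
    by apply: (smooth_continuous (n := 0)); case: eH.
  exists (fun p : 'rV[R]_3 => (p ord0 0 * v ord0 0 + p ord0 1 * v ord0 1) * hadamard (derive1 H) (axial_radius p)).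
    apply: alg_mul; last first.
      by apply/alg_gen/gen_radial/even0_hadamard/odd0_derive1.
    by apply: alg_add; (apply: alg_mul; [exact/alg_gen/gen_coord|exact: alg_cst]).
  by move=> p; exact: is_derive_radial.
Qed.

(** * A primitive of omega *)

Lemma row3P (R : realType) (p q : 'rV[R]_3) :
  co0 p = co0 q -> co1 p = co1 q -> co2 p = co2 q -> p = q.
Proof.
move=> h0 h1 h2; apply/rowP => i.
case: i => [[|[|[|//]]] hi].
- by have -> : Ordinal hi = 0 by exact: val_inj.
- by have -> : Ordinal hi = 1 by exact: val_inj.
- by have -> : Ordinal hi = 2 by exact: val_inj.
Qed.

Lemma vec3_0 (R : realType) (a b c : R) : co0 (vec3 a b c) = a.
Proof. by rewrite mxE. Qed.
Lemma vec3_1 (R : realType) (a b c : R) : co1 (vec3 a b c) = b.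
Proof. by rewrite mxE. Qed.
Lemma vec3_2 (R : realType) (a b c : R) : co2 (vec3 a b c) = c.
Proof. by rewrite mxE. Qed.
Definition vec3E := (vec3_0, vec3_1, vec3_2).

Lemma is_derive_row (R : realType) (V : normedModType R) (M : V -> 'rV[R]_3) (p v : V) d :
  is_derive p v M d <-> forall i, is_derive p v (fun x => M x ord0 i) (d ord0 i).
Proof.
split=> [[dM <-] i|h].
  split; first exact: ((derivable_mxP _ _ _).1 dM ord0 i).
  by rewrite derive_mx// mxE.
have dM : derivable M p v.
  by apply/derivable_mxP => i j; rewrite (ord1 i); have [] := h j.
split=> //; rewrite derive_mx//; apply/rowP => i; rewrite mxE.
by have [] := h i.
Qed.

Lemma is_derive_vec3 (R : realType) (V : normedModType R) (a b c : V -> R) (p v : V)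
    (da db dc : R) :
  is_derive p v a da -> is_derive p v b db -> is_derive p v c dc ->
  is_derive p v (fun x => vec3 (a x) (b x) (c x)) (vec3 da db dc).
Proof.
move=> ha hb hc; apply/is_derive_row => i.
case: i => [[|[|[|//]]] hi]; rewrite mxE /=.
- by under eq_fun do rewrite mxE /=.
- by under eq_fun do rewrite mxE /=.
- by under eq_fun do rewrite mxE /=.
Qed.

(** The differential of the change of coordinates from Polar to North at p, applied to v. *)
Definition dpolar (R : realType) (p v : 'rV[R]_3) : 'rV[R]_3 :=
  vec3 (cos (co2 p) * co0 v - co0 p * sin (co2 p) * co2 v)
       (sin (co2 p) * co0 v + co0 p * cos (co2 p) * co2 v) (co1 v + co2 v).

Lemma is_derive_coord3 (R : realType) (i : 'I_3) (p v : 'rV[R]_3) :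
  is_derive p v (fun p : 'rV[R]_3 => p ord0 i) (v ord0 i).
Proof. by apply: is_derive_line0; exact: is_derive_coord. Qed.

Lemma is_derive_north (R : realType) (l : R) (p v : 'rV[R]_3) :
  is_derive p v (from_polar l North) (dpolar p v).
Proof.
apply: is_derive_vec3.
- apply: is_derive_eq (is_deriveM (is_derive_coord3 0 p v)
    (is_derive_fun_coord 2 p v (@is_derive_cos R))) _.
  by rewrite /GRing.scale /=; ring.
- apply: is_derive_eq (is_deriveM (is_derive_coord3 0 p v)
    (is_derive_fun_coord 2 p v (@is_derive_sin R))) _.
  by rewrite /GRing.scale /=; ring.
- exact: is_deriveD (is_derive_coord3 1 p v) (is_derive_coord3 2 p v).
Qed.

(* Reversing the latitude and the longitude turns the chart around the south
   pole into a chart around the north pole. *)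
Definition flip (R : realType) (l : R) (p : 'rV[R]_3) : 'rV[R]_3 :=
  vec3 (l - co0 p) (co1 p + pi) (- co2 p).
Definition dflip (R : realType) (v : 'rV[R]_3) : 'rV[R]_3 :=
  vec3 (- co0 v) (co1 v) (- co2 v).

Lemma from_polar_south (R : realType) (l : R) (p : 'rV[R]_3) :
  from_polar l South p = from_polar l North (flip l p).
Proof. by rewrite /from_polar /flip !vec3E addrAC. Qed.

Lemma is_derive_south (R : realType) (l : R) (p v : 'rV[R]_3) :
  is_derive p v (from_polar l South) (dpolar (flip l p) (dflip v)).
Proof.
have cosN' (x : R) : is_derive x 1 (fun x : R => cos (- x)) (- sin x).
  by under eq_fun do rewrite cosN; exact: is_derive_cos.
have sinN' (x : R) : is_derive x 1 (fun x : R => sin (- x)) (- cos x).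
  by under eq_fun do rewrite sinN; apply: is_deriveN.
have d0 : is_derive p v (fun p : 'rV[R]_3 => l - co0 p) (0 - co0 v).
  exact: is_deriveB (is_derive_cst l p v) (is_derive_coord3 0 p v).
rewrite /dpolar /flip /dflip !vec3E; apply: is_derive_vec3.
- apply: is_derive_eq (is_deriveM d0 (is_derive_fun_coord 2 p v cosN')) _.
  by rewrite /GRing.scale /= sinN; ring.
- apply: is_derive_eq (is_deriveM d0 (is_derive_fun_coord 2 p v sinN')) _.
  by rewrite /GRing.scale /= cosN sinN; ring.
- apply: is_derive_eq (is_deriveB (is_deriveD (is_derive_coord3 1 p v) (is_derive_cst pi p v))
    (is_derive_coord3 2 p v)) _.
  by rewrite addr0.
Qed.

(** Here lambda is multiplied out to cos phi dt + G sin phi dtheta, which needs no division by G,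
    and [antiderivative G t - 1] is Gamma. *)
Definition polar_form (R : realType) (m : R) (G : R -> R) (p v : 'rV[R]_3) : R :=
  m * (cos (co1 p) * co0 v + G (co0 p) * sin (co1 p) * co2 v) + co1 v
  - (antiderivative G (co0 p) - 1) * co2 v.

(* The polar form in the coordinates (x, y, chi): since G is odd and G'(0) = 1,
   G t = t (1 + t^2 k t) and the antiderivative is t^2 n t, with k and n even. *)
Definition north_form (R : realType) (m : R) (G : R -> R) (q v : 'rV[R]_3) : R :=
  m * (cos (co2 q) * co0 v + sin (co2 q) * co1 v
       + hadamard (hadamard (hadamard G)) (axial_radius q)
         * (co0 q * sin (co2 q) - co1 q * cos (co2 q))
         * (co0 q * co1 v - co1 q * co0 v)) + co2 v
  - hadamard (hadamard (antiderivative G)) (axial_radius q)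
    * (co0 q * co1 v - co1 q * co0 v).

(** With chi = phi + theta one has cos chi dx + sin chi dy = cos phi dt + t sin phi dtheta, x sin
    chi - y cos chi = t sin phi and x dy - y dx = t^2 dtheta. So the first two terms of the north
    form are lambda of the flat metric, and the term with k = (G - t) / t^3 is the deviation from
    it. *)
Lemma polar_north_form (R : realType) (m l : R) (G : R -> R) (p v : 'rV[R]_3) :
  odd0 G -> derive1 G 0 = 1 -> 0 <= co0 p ->
  polar_form m G p v = north_form m G (from_polar l North p) (dpolar p v).
Proof.
move=> oG G1 p0; have [sG _] := oG.
have eh := even0_hadamard oG; have [sh _] := eh.
have oh := odd0_hadamard eh; have [sh2 _] := oh.
have h0 : hadamard G 0 = 1 by rewrite hadamard0.
have GE : G (co0 p) = co0 p * (1 + co0 p ^+ 2 * hadamard (hadamard (hadamard G)) (co0 p)).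
  rewrite [LHS](hadamardE _ sG) (hadamardE _ sh) (hadamardE _ sh2).
  by rewrite (odd0_at0 oG) h0 (odd0_at0 oh); ring.
have eN := even0_antiderivative oG; have [sN _] := eN.
have oN := odd0_hadamard eN; have [sN2 _] := oN.
have NE : antiderivative G (co0 p) =
    co0 p ^+ 2 * hadamard (hadamard (antiderivative G)) (co0 p).
  rewrite [LHS](hadamardE _ sN) (hadamardE _ sN2).
  by rewrite antiderivative0 (odd0_at0 oN); ring.
have rE : axial_radius (from_polar l North p) = co0 p.
  rewrite /axial_radius /from_polar !vec3E !exprMn -mulrDr cos2Dsin2 mulr1.
  by rewrite sqrtr_sqr ger0_norm.
rewrite /polar_form /north_form rE NE GE /dpolar /from_polar !vec3E cosD sinD.
set k := hadamard _ _; set n := hadamard _ _.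
set t := co0 p; set c := cos (co2 p); set s := sin (co2 p).
set C := cos (co1 p); set S := sin (co1 p).
have cs : c ^+ 2 + s ^+ 2 = 1 by exact: cos2Dsin2.
move: (co0 v) (co1 v) (co2 v) => v0 v1 v2.
(* The factors c^2 + s^2 are placed where the change of coordinates produces them, so that one side
   is a polynomial identity and the other follows by replacing them by 1. *)
transitivity (m * ((c ^+ 2 + s ^+ 2) * (C * v0 + t * S * v2)
    + k * (t * S * (c ^+ 2 + s ^+ 2)) * (t ^+ 2 * (c ^+ 2 + s ^+ 2) * v2))
  + (v1 + v2) - n * (t ^+ 2 * (c ^+ 2 + s ^+ 2) * v2)); last by ring.
by rewrite cs; ring.
Qed.

(** The antiderivatives taken from the two ends add up to the constant 2, so [antiderivative G - 1]
    changes sign together with dtheta. In lambda the signs of dt and dtheta are absorbed by the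
    shift of phi by pi. *)
Lemma polar_flip (R : realType) (m l : R) (G : R -> R) (p v : 'rV[R]_3) :
  smooth G -> antiderivative G l = 2 ->
  polar_form m G p v = polar_form m (fun u => G (l - u)) (flip l p) (dflip v).
Proof.
move=> sG Gl; rewrite /polar_form /flip /dflip !vec3E subKr cosDpi sinDpi.
have [sG' _] := smooth_reflect l sG.
have E : antiderivative (fun u => G (l - u)) (l - co0 p) + antiderivative G (co0 p) = 2.
  pose F (t : R) := antiderivative (fun u => G (l - u)) (l - t) + antiderivative G t.
  have dF (t : R) : is_derive t 1 F 0.
    have h1 := @is_derive_comp _ (antiderivative (fun u => G (l - u))) (fun t => l - t) t _ _
      (is_derive_antiderivative (l - t) sG') (is_derive_csub l t).
    have h2 := is_derive_antiderivative t sG.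
    by apply: is_derive_eq (is_derive_add h1 h2) _; rewrite subKr; ring.
  rewrite -/(F (co0 p)) (is_derive_0_is_cst _ l dF) /F subrr antiderivative0 add0r.
  exact: Gl.
have -> : antiderivative G (co0 p) = 2 - antiderivative (fun u => G (l - u)) (l - co0 p).
  by rewrite -E addrAC subrr add0r.
ring.
Qed.

Definition global_form (R : realType) (m l : R) (G : R -> R) : form1 R := fun i =>
  match i with
  | Polar => polar_form m G
  | North => north_form m G
  | South => north_form m (fun u => G (l - u))
  end.

Lemma alg_opp (R : realType) (B : ('rV[R]_3 -> R) -> Prop) f :
  alg B f -> alg B (fun p => - f p).
Proof.
move=> hf; have -> : (fun p => - f p) = (fun p => -1 * f p).
  by apply/funext => p; rewrite mulN1r.
by apply: alg_mul => //; exact: alg_cst.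
Qed.

Lemma alg_polar_form (R : realType) (m : R) (G : R -> R) (v : 'rV[R]_3) :
  smooth G -> alg (@generator R) (fun p => polar_form m G p v).
Proof.
move=> sG; rewrite /polar_form.
have sN : smooth (antiderivative G).
  move=> [|n] x; first by have [] := is_derive_antiderivative x sG.
  by rewrite derive1Sn antiderivative_derive1.
have aG := alg_gen (gen_fun 0 sG); have aN := alg_gen (gen_fun 0 sN).
have ac := alg_gen (@gen_cos R 1); have as_ := alg_gen (@gen_sin R 1).
repeat first [exact: alg_cst | exact: aG | exact: aN | exact: ac | exact: as_ |
  apply: alg_opp | apply: alg_add | apply: alg_mul].
Qed.

Lemma alg_north_form (R : realType) (m : R) (G : R -> R) (v : 'rV[R]_3) :
  odd0 G -> alg (@generator R) (fun p => north_form m G p v).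
Proof.
move=> oG; rewrite /north_form.
have ek := even0_hadamard (odd0_hadamard (even0_hadamard oG)).
have en := even0_hadamard (odd0_hadamard (even0_antiderivative oG)).
have ac := alg_gen (@gen_cos R 2); have as_ := alg_gen (@gen_sin R 2).
have ax := alg_gen (@gen_coord R 0); have ay := alg_gen (@gen_coord R 1).
have ak := alg_gen (gen_radial ek); have an := alg_gen (gen_radial en).
repeat first [exact: alg_cst | exact: ak | exact: an | exact: ac | exact: as_ |
  exact: ax | exact: ay | apply: alg_opp | apply: alg_add | apply: alg_mul].
Qed.

Lemma scaleD_coord (R : realType) (a : R) (u v : 'rV[R]_3) (i : 'I_3) :
  (a *: u + v) ord0 i = a * u ord0 i + v ord0 i.
Proof. by rewrite !mxE. Qed.

Lemma polar_form_scalar (R : realType) (m : R) (G : R -> R) p : scalar (@polar_form R m G p).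
Proof.
move=> a u v; rewrite /polar_form !scaleD_coord.
by move: (G _) (antiderivative _ _) (cos _) (sin _) => k n c s; ring.
Qed.

Lemma north_form_scalar (R : realType) (m : R) (G : R -> R) p : scalar (@north_form R m G p).
Proof.
move=> a u v; rewrite /north_form !scaleD_coord.
move: (hadamard _ _) (hadamard _ _) (cos _) (sin _) => k n c s.
by move: (co0 p) (co1 p) => x y; ring.
Qed.

Lemma north_form_periodic (R : realType) (m : R) (G : R -> R) (q v : 'rV[R]_3) :
  north_form m G (q + vec3 0 0 (2 * pi)) v = north_form m G q v.
Proof.
have E0 : co0 (q + vec3 0 0 (2 * pi)) = co0 q by rewrite mxE vec3E addr0.
have E1 : co1 (q + vec3 0 0 (2 * pi)) = co1 q by rewrite mxE vec3E addr0.
have E2 : co2 (q + vec3 0 0 (2 * pi)) = co2 q + pi *+ 2.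
  by rewrite mxE vec3E mulr_natl.
by rewrite /north_form /axial_radius E0 E1 E2 cosD2pi sinD2pi.
Qed.

Lemma smooth_global_form (R : realType) (m l : R) (G : R -> R) :
  odd0 G -> odd0 (fun u => G (l - u)) -> derive1 G 0 = 1 -> derive1 G l = -1 ->
  antiderivative G l = 2 -> smooth_form1 l (global_form m l G).
Proof.
move=> oG oG' G0 Gl GN; have [sG _] := oG.
have G'0 : derive1 (fun u => G (l - u)) 0 = 1.
  have [_ /(_ 1%N 0)] := smooth_reflect l sG.
  by rewrite !derive1n1 subr0 Gl expr1 mulrNN mulr1.
split.
- by case=> p _ /=; [exact: polar_form_scalar|exact: north_form_scalar|exact: north_form_scalar].
- have cg := @generator_derivation_closed R.
  by case=> v; apply: alg_smooth_on cg _ => /=;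
    [exact: alg_polar_form|exact: alg_north_form|exact: alg_north_form].
- case=> p v /= /andP[p0 pl].
  + by rewrite derive_id.
  + rewrite (polar_north_form m l v oG G0 (ltW p0)).
    by rewrite (@derive_val _ _ _ _ _ _ _ (is_derive_north l p v)).
  + rewrite (@derive_val _ _ _ _ _ _ _ (is_derive_south l p v)).
    rewrite (polar_flip m p v sG GN) -/(from_polar l South p) from_polar_south.
    by apply: polar_north_form => //; rewrite vec3E subr_ge0 ltW.
- by case=> q v // _ _ /=; exact: north_form_periodic.
Qed.

Lemma derive_lambda_form (R : realType) (G : R -> R) (p w z : 'rV[R]_3) :
  smooth G -> 'D_w (fun q => lambda_form G q z) p =
    - (co1 w * sin (co1 p) * co0 z) + (co0 w * derive1 G (co0 p) * sin (co1 p)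
       + G (co0 p) * co1 w * cos (co1 p)) * co2 z.
Proof.
move=> sG.
have lE q : lambda_form G q z =
    cos (co1 q) * co0 z + G (co0 q) * (sin (co1 q) * co2 z).
  rewrite /lambda_form /metric /=; congr (_ + _).
  (* Both sides lose their dtheta term where G vanishes, whatever the value of 1 / 0. The identity
     thus holds everywhere and can be used under the derivative. *)
  have [->|g0] := eqVneq (G (co0 q)) 0; first by rewrite expr0n /= !mul0r.
  by field.
have dG := is_derive_fun_coord 0 p w (fun x => smooth_is_derive1 x sG).
have dc := is_derive_fun_coord 1 p w (@is_derive_cos R).
have ds := is_derive_fun_coord 1 p w (@is_derive_sin R).
under eq_fun do rewrite lE.
have h := is_derive_add (is_derive_mul dc (is_derive_cst (co0 z) p w))
  (is_derive_mul dG (is_derive_mul ds (is_derive_cst (co2 z) p w))).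
rewrite (@derive_val _ _ _ _ _ _ _ h) /=; ring.
Qed.

Lemma derive_polar_form (R : realType) (m : R) (G : R -> R) (p w z : 'rV[R]_3) :
  smooth G -> 'D_w (fun q => polar_form m G q z) p =
    m * 'D_w (fun q => lambda_form G q z) p - co0 w * G (co0 p) * co2 z.
Proof.
move=> sG; rewrite derive_lambda_form// /polar_form.
have dG := is_derive_fun_coord 0 p w (fun x => smooth_is_derive1 x sG).
have dN := is_derive_fun_coord 0 p w (fun x => is_derive_antiderivative x sG).
have dc := is_derive_fun_coord 1 p w (@is_derive_cos R).
have ds := is_derive_fun_coord 1 p w (@is_derive_sin R).
have h := is_derive_sub (is_derive_add (is_derive_cmul m
 (is_derive_add (is_derive_mul dc (is_derive_cst (co0 z) p w))
  (is_derive_mul (is_derive_mul dG ds) (is_derive_cst (co2 z) p w))))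
   (is_derive_cst (co1 z) p w))
   (is_derive_mul (is_derive_sub dN (is_derive_cst (1 : R) p w)) (is_derive_cst (co2 z) p w)).
rewrite (@derive_val _ _ _ _ _ _ _ h) /=; ring.
Qed.

Lemma global_form_primitive (R : realType) (m l : R) (G : R -> R) (p u v : 'rV[R]_3) :
  smooth G -> ext_deriv (global_form m l G Polar) p u v = omega G m p u v.
Proof.
by move=> sG; rewrite /omega /ext_deriv /area_form /= !derive_polar_form//; ring.
Qed.

(** * Integrals of a primitive along loops in a latitude *)

Lemma vec3_lin (R : realType) (a b c : R) :
  vec3 a b c = a *: vec3 1 0 0 + (b *: vec3 0 1 0 + c *: vec3 0 0 1).
Proof.
by apply: row3P; rewrite !scaleD_coord !mxE /=; ring.
Qed.

Lemma cvg_vec3 (R : realType) (T : Type) (F : set_system T) (FF : Filter F)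
    (a b c : T -> R) (a0 b0 c0 : R) :
  (a x @[x --> F] --> a0) -> (b x @[x --> F] --> b0) -> (c x @[x --> F] --> c0) ->
  (fun x => vec3 (a x) (b x) (c x)) @ F --> vec3 a0 b0 c0.
Proof.
move=> ha hb hc; under eq_fun do rewrite vec3_lin.
rewrite (vec3_lin a0 b0 c0).
by apply: cvgD; [|apply: cvgD]; apply: cvgZ => //; exact: cvg_cst.
Qed.

Lemma joint_continuous_comp3 (R : realType) (H : 'rV[R]_3 -> R) (a b c : R -> R -> R) (t s : R) :
  joint_continuous a t s -> joint_continuous b t s -> joint_continuous c t s ->
  {for vec3 (a t s) (b t s) (c t s), continuous H} ->
  joint_continuous (fun t s => H (vec3 (a t s) (b t s) (c t s))) t s.
Proof.
move=> ha hb hc hH; apply/joint_continuousP.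
have hv : (fun p : R * R => vec3 (a p.1 p.2) (b p.1 p.2) (c p.1 p.2)) @ (t, s)
    --> vec3 (a t s) (b t s) (c t s) by exact: cvg_vec3 ha hb hc.
exact: cvg_comp _ _ hv hH.
Qed.

Lemma joint_continuous_fun1 (R : realType) (F : R -> R) (t s : R) :
  continuous F -> joint_continuous (fun t _ => F t) t s.
Proof.
move=> cF; apply/joint_continuousP.
have c1 : (fun p : R * R => p.1) @ (t, s) --> t by exact: cvg_fst.
exact: cvg_comp _ _ c1 (cF t).
Qed.

Lemma joint_continuous_fun2 (R : realType) (F : R -> R) (t s : R) :
  continuous F -> joint_continuous (fun _ s => F s) t s.
Proof.
move=> cF; apply/joint_continuousP.
have c1 : (fun p : R * R => p.2) @ (t, s) --> s by exact: cvg_snd.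
exact: cvg_comp _ _ c1 (cF s).
Qed.

Lemma joint_continuous_mul (R : realType) (f h : R -> R -> R) (t s : R) :
  joint_continuous f t s -> joint_continuous h t s -> joint_continuous (fun t s => f t s * h t s) t s.
Proof. by move=> cf ch; exact: cvgM cf ch. Qed.

Lemma joint_continuous_add (R : realType) (f h : R -> R -> R) (t s : R) :
  joint_continuous f t s -> joint_continuous h t s -> joint_continuous (fun t s => f t s + h t s) t s.
Proof. by move=> cf ch; exact: cvgD cf ch. Qed.

Lemma affine_continuous (R : realType) (a b : R) : continuous (fun s : R => a + s * b).
Proof.
move=> s; apply: (@is_derive_continuous _ _ _ (0 + b)).
exact: is_derive_add (is_derive_cst a s 1) (is_derive_mulr b s).
Qed.

Lemma scalar_vec3 (R : realType) (f : 'rV[R]_3 -> R) (a b c : R) : scalar f ->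
  f (vec3 a b c) = a * f (vec3 1 0 0) + (b * f (vec3 0 1 0) + c * f (vec3 0 0 1)).
Proof.
move=> sf; have f0 : f 0 = 0.
  by have := sf (-1) 0 0; rewrite scaler0 addr0 mulN1r addNr.
rewrite (vec3_lin a b c) sf sf; congr (_ + (_ + _)).
by have := sf c (vec3 0 0 1) 0; rewrite addr0 => ->; rewrite f0 addr0.
Qed.

Section loops.
Variables (R : realType) (l m : R) (g : R -> R) (a : form1 R).
Hypothesis sa : smooth_form1 l a.

(** One family for both loops: (al, be) = (0, w) runs along theta and (w, 0) along phi. The summand
    0 gives the longitude the same affine form as phi. *)
Definition loop (phi0 al be t s : R) : 'rV[R]_3 := vec3 t (phi0 + s * al) (0 + s * be).

Definition loop_integral (phi0 al be T t : R) : R :=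
  \int[lebesgue_measure]_(s in `[0, T]) a Polar (loop phi0 al be t s) (vec3 0 al be).

Lemma loop_line_t (phi0 al be t s : R) :
  loop phi0 al be t s = t *: vec3 1 0 0 + vec3 0 (phi0 + s * al) (s * be).
Proof. by apply: row3P; rewrite scaleD_coord !mxE /=; ring. Qed.

Lemma loop_line_s (phi0 al be t s : R) :
  loop phi0 al be t s = s *: vec3 0 al be + vec3 t phi0 0.
Proof. by apply: row3P; rewrite scaleD_coord !mxE /=; ring. Qed.

Lemma is_derive_loop_s (H : 'rV[R]_3 -> R) (phi0 al be t s : R) :
  derivable H (loop phi0 al be t s) (vec3 0 al be) ->
  is_derive s 1 (fun s => H (loop phi0 al be t s))
    ('D_(vec3 0 al be) H (loop phi0 al be t s)).
Proof.
move=> /derivableP; rewrite loop_line_s => /is_derive_line.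
by under [X in is_derive _ _ X _ -> _]eq_fun do rewrite -loop_line_s.
Qed.

Lemma is_derive_loop_t (H : 'rV[R]_3 -> R) (phi0 al be t s : R) :
  derivable H (loop phi0 al be t s) (vec3 1 0 0) ->
  is_derive t 1 (fun t => H (loop phi0 al be t s))
    ('D_(vec3 1 0 0) H (loop phi0 al be t s)).
Proof.
move=> /derivableP; rewrite loop_line_t => /is_derive_line.
by under [X in is_derive _ _ X _ -> _]eq_fun do rewrite -loop_line_t.
Qed.

Lemma joint_continuous_loop (phi0 al be t s : R) (H : 'rV[R]_3 -> R) :
  {for loop phi0 al be t s, continuous H} ->
  joint_continuous (fun t s => H (loop phi0 al be t s)) t s.
Proof.
move=> cH; apply: (@joint_continuous_comp3 _ H (fun t _ => t) (fun _ s => phi0 + s * al)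
  (fun _ s => 0 + s * be)) => //.
- by apply: (@joint_continuous_fun1 _ (fun t => t)) => x; exact: cvg_id.
- by apply: (@joint_continuous_fun2 _ (fun s => phi0 + s * al)); exact: affine_continuous.
- by apply: (@joint_continuous_fun2 _ (fun s => 0 + s * be)); exact: affine_continuous.
Qed.

Lemma loop_domain (phi0 al be t s : R) :
  0 < t < l -> chart_domain l Polar (loop phi0 al be t s).
Proof. by move=> h /=; rewrite vec3E. Qed.

(** With e = d/dt and u the velocity of the loop, the derivative of a(u) along e is the derivative
    of a(e) along u plus omega(e, u). The first integrates to zero because a(e) takes equal values
    at the two ends, the second to the increment of W. *)
Lemma is_derive_loop_integral (phi0 al be T t : R) (W : R -> R) :
  0 < T -> 0 < t < l ->
  (forall p u v, chart_domain l Polar p -> ext_deriv (a Polar) p u v = omega g m p u v) ->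
  (forall s : R, is_derive s 1 W (omega g m (loop phi0 al be t s) (vec3 1 0 0) (vec3 0 al be))) ->
  a Polar (loop phi0 al be t T) (vec3 1 0 0) = a Polar (loop phi0 al be t 0) (vec3 1 0 0) ->
  is_derive t 1 (loop_integral phi0 al be T) (W T - W 0).
Proof.
move=> T0 tl da dW aT; have [_ sm _ _] := sa.
set u := vec3 0 al be; set e : 'rV[R]_3 := vec3 1 0 0.
pose f' t s := 'D_e (fun p => a Polar p u) (loop phi0 al be t s).
have cf' x s : 0 < x < l -> joint_continuous f' x s.
  move=> xl; apply: (@joint_continuous_loop _ _ _ _ _ (fun p => 'D_e (fun p => a Polar p u) p)).
  by have [] := sm Polar u [:: e] _ (loop_domain phi0 al be s xl).
have <- : \int[lebesgue_measure]_(s in `[0, T]) f' t s = W T - W 0.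
  transitivity ((a Polar (loop phi0 al be t T) e + W T) -
    (a Polar (loop phi0 al be t 0) e + W 0)); last by rewrite aT; ring.
  apply: (@Rintegral_derive _ (f' t)
    (fun s => a Polar (loop phi0 al be t s) e + W s) 0 T T0).
  - move=> s _.
    have hs := loop_domain phi0 al be s tl.
    have d1 : is_derive s 1 (fun s => a Polar (loop phi0 al be t s) e)
        ('D_u (fun p => a Polar p e) (loop phi0 al be t s)).
      apply: (@is_derive_loop_s (fun p => a Polar p e)).
      by have [_] := sm Polar e [::] _ hs; apply.
    apply: is_derive_eq (is_derive_add d1 (dW s)) _.
    by rewrite -(da _ _ _ hs) /ext_deriv /f'; ring.
  - by move=> s _; exact: joint_continuous_slice (cf' t s tl).
apply: is_derive_integral.
have [t_gt0 t_ltl] := andP tl.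
near=> x; have xl : 0 < x < l.
  by apply/andP; split; near: x; [exact: lt_nbhsr|exact: lt_nbhsl].
move=> s _; have hs := loop_domain phi0 al be s xl; split.
- apply: (@joint_continuous_loop _ _ _ _ _ (fun p => a Polar p u)).
  by have [] := sm Polar u [::] _ hs.
- exact: cf'.
- apply: (@is_derive_loop_t (fun p => a Polar p u)).
  by have [_] := sm Polar u [::] _ hs; apply.
Unshelve. all: by end_near. Qed.

Definition axis_integral (i : chart) (chi ka T : R) : R :=
  \int[lebesgue_measure]_(s in `[0, T]) (ka * a i (vec3 0 0 (chi + s * ka)) (vec3 0 0 1)).

(* A loop around a pole can be shrunk to the fibre over the pole. *)
Lemma loop_integral_cap (i : chart) (x y c x' y' c' : R -> R -> R)
    (t1 phi0 al be T chi ka : R) (F : set_system R) :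
  Filter F -> F --> nbhs t1 ->
  (forall t s, [/\ joint_continuous x t s, joint_continuous y t s & joint_continuous c t s]) ->
  (forall t s, [/\ joint_continuous x' t s, joint_continuous y' t s & joint_continuous c' t s]) ->
  (\forall t \near t1, forall s, chart_domain l i (vec3 (x t s) (y t s) (c t s))) ->
  (\forall t \near F, forall s, a Polar (loop phi0 al be t s) (vec3 0 al be) =
    a i (vec3 (x t s) (y t s) (c t s)) (vec3 (x' t s) (y' t s) (c' t s))) ->
  (forall s, vec3 (x t1 s) (y t1 s) (c t1 s) = vec3 0 0 (chi + s * ka) /\
    vec3 (x' t1 s) (y' t1 s) (c' t1 s) = vec3 0 0 ka) ->
  loop_integral phi0 al be T @ F --> axis_integral i chi ka T.
Proof.
move=> FF Ft1 cx cx' dom aE at1; have [lin sm _ _] := sa.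
(* Expanded by linearity in the cap chart, the integrand is defined and continuous on a full
   neighbourhood of t1, also beyond the pole. It is compared with the polar integrand only along
   F. *)
pose f t s := x' t s * a i (vec3 (x t s) (y t s) (c t s)) (vec3 1 0 0) +
    (y' t s * a i (vec3 (x t s) (y t s) (c t s)) (vec3 0 1 0) +
     c' t s * a i (vec3 (x t s) (y t s) (c t s)) (vec3 0 0 1)).
have fE t s : chart_domain l i (vec3 (x t s) (y t s) (c t s)) -> f t s =
    a i (vec3 (x t s) (y t s) (c t s)) (vec3 (x' t s) (y' t s) (c' t s)).
  by move=> hd; rewrite /f -scalar_vec3//; exact: lin.
have -> : axis_integral i chi ka T = \int[lebesgue_measure]_(s in `[0, T]) f t1 s.
  apply: eq_Rintegral => s _; rewrite fE; last exact: (nbhs_singleton dom).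
  have hd : chart_domain l i (vec3 0 0 (chi + s * ka)).
    by have [<- _] := at1 s; exact: (nbhs_singleton dom).
  have [-> ->] := at1 s.
  by rewrite (scalar_vec3 0 0 ka (lin i _ hd)) !mul0r !add0r.
have h : (fun t => \int[lebesgue_measure]_(s in `[0, T]) f t s) @ t1 -->
    \int[lebesgue_measure]_(s in `[0, T]) f t1 s.
  apply: (@continuous_integral _ f); apply: filterS dom => t hd s _.
  have [cx1 cx2 cx3] := cx t s; have [cx1' cx2' cx3'] := cx' t s.
  have ca v : joint_continuous (fun t s => a i (vec3 (x t s) (y t s) (c t s)) v) t s.
    apply: (@joint_continuous_comp3 _ (fun p => a i p v)) => //.
    by have [] := sm i v [::] _ (hd s).
  exact: joint_continuous_add (joint_continuous_mul cx1' (ca _)) (joint_continuous_add (joint_continuous_mul cx2' (ca _))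
    (joint_continuous_mul cx3' (ca _))).
have hF : (fun t => \int[lebesgue_measure]_(s in `[0, T]) f t s) @ F -->
    \int[lebesgue_measure]_(s in `[0, T]) f t1 s.
  exact: cvg_trans (cvg_app _ Ft1) h.
apply: cvg_trans hF; apply: near_eq_cvg.
have domF := Ft1 _ dom.
apply: filterS2 domF aE => t hd hE.
by apply: eq_Rintegral => s _; rewrite fE// -hE.
Qed.

Lemma joint_continuous_loop_phi (phi0 al : R) t s : joint_continuous (fun _ s => phi0 + s * al) t s.
Proof. exact: joint_continuous_fun2 (@affine_continuous R phi0 al). Qed.

Lemma joint_continuous_loop_trig (F : R -> R) (be : R) : continuous F ->
  forall t s, joint_continuous (fun _ s => F (s * be)) t s.
Proof.
move=> cF t s; apply: (@joint_continuous_fun2 _ (fun s => F (s * be))) => {}s.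
apply: (@continuous_comp _ _ _ (fun s : R => s * be) F); last exact: cF.
exact: is_derive_continuous (is_derive_mulr be s).
Qed.

Lemma joint_continuous_id1 (t s : R) : joint_continuous (fun t _ => t) t s.
Proof. by apply: (@joint_continuous_fun1 _ (fun t => t)) => x; exact: cvg_id. Qed.

Lemma loop_integral_north (phi0 al be T : R) : 0 < l ->
  loop_integral phi0 al be T @ 0^'+ --> axis_integral North phi0 (al + be) T.
Proof.
move=> l0; have [_ _ pol _] := sa.
pose d t s := dpolar (loop phi0 al be t s) (vec3 0 al be).
pose q t s := from_polar l North (loop phi0 al be t s).
have cs := @joint_continuous_loop_trig _ be (@continuous_cos R).
have sn := @joint_continuous_loop_trig _ be (@continuous_sin R).
have jt (t s : R) F : joint_continuous F t s -> joint_continuous (fun t s => t * F t s) t s.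
  by move=> cF; have := @joint_continuous_mul R (fun t _ => t) F t s (@joint_continuous_id1 t s) cF.
have Eq t s : q t s = vec3 (t * cos (s * be)) (t * sin (s * be)) (phi0 + s * (al + be)).
  by rewrite /q /from_polar /loop !vec3E !add0r; congr vec3; ring.
have Ed t s : d t s = vec3 (- 1 * (t * sin (s * be) * be)) (t * cos (s * be) * be) (al + be).
  by rewrite /d /dpolar /loop !vec3E !add0r; congr vec3; ring.
have jc (k : R) t s : joint_continuous (fun _ _ : R => k) t s.
  by apply: (@joint_continuous_fun1 _ (fun=> k)); exact: cst_continuous.
apply: (@loop_integral_cap North (fun t s => t * cos (s * be)) (fun t s => t * sin (s * be))
  (fun t s => phi0 + s * (al + be)) (fun t s => - 1 * (t * sin (s * be) * be))
  (fun t s => t * cos (s * be) * be) (fun _ _ => al + be) 0).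
- exact: cvg_within.
- move=> t s; split; [exact: jt (cs _ _)
    |exact: jt (sn _ _)|exact: joint_continuous_loop_phi].
- move=> t s; split; last exact: jc.
    by apply: joint_continuous_mul (jc _ _ _) _; apply: joint_continuous_mul (jc _ _ _);
      exact: jt (sn _ _).
  by apply: joint_continuous_mul (jc _ _ _); exact: jt (cs _ _).
- near=> t => s /=; rewrite !vec3E !exprMn -mulrDr cos2Dsin2 mulr1.
  have tl : `|t| < l.
    by near: t; apply/nbhs_normP; exists l => // y; rewrite /ball_ /= sub0r normrN.
  by rewrite -[t ^+ 2]real_normK ?num_real// ltr_pXn2r ?nnegrE ?(ltW l0)//.
- near=> t => s; rewrite -Eq -Ed.
  have tl : 0 < t < l.
    by apply/andP; split; near: t; [exact: nbhs_right_gt|exact: nbhs_right_lt].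
  rewrite (pol North _ _ (loop_domain phi0 al be s tl)).
  by rewrite (@derive_val _ _ _ _ _ _ _ (is_derive_north _ _ _)).
- by move=> s; split; congr vec3; ring.
Unshelve. all: by end_near. Qed.

Lemma loop_integral_south (phi0 al be T : R) : 0 < l ->
  loop_integral phi0 al be T @ l^'- --> axis_integral South (phi0 + pi) (al - be) T.
Proof.
move=> l0; have [_ _ pol _] := sa.
pose d t s := dpolar (flip l (loop phi0 al be t s)) (dflip (vec3 0 al be)).
pose q t s := from_polar l South (loop phi0 al be t s).
have cs := @joint_continuous_loop_trig _ be (@continuous_cos R).
have sn := @joint_continuous_loop_trig _ be (@continuous_sin R).
have Eq t s : q t s = vec3 ((l - t) * cos (s * be)) (- 1 * ((l - t) * sin (s * be)))
    (phi0 + pi + s * (al - be)).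
  rewrite /q from_polar_south /from_polar /flip /loop !vec3E !add0r cosN sinN.
  by congr vec3; ring.
have Ed t s : d t s = vec3 (- 1 * ((l - t) * sin (s * be) * be))
    (- 1 * ((l - t) * cos (s * be) * be)) (al - be).
  rewrite /d /dpolar /flip /dflip /loop !vec3E !add0r cosN sinN.
  by congr vec3; ring.
have jc (k : R) t s : joint_continuous (fun _ _ : R => k) t s.
  by apply: (@joint_continuous_fun1 _ (fun=> k)); exact: cst_continuous.
have jl t s : joint_continuous (fun t _ => l - t) t s.
  by apply: (@joint_continuous_fun1 _ (fun t => l - t)) => x; exact: is_derive_continuous (is_derive_csub l x).
apply: (@loop_integral_cap South (fun t s => (l - t) * cos (s * be))
  (fun t s => - 1 * ((l - t) * sin (s * be)))
  (fun t s => phi0 + pi + s * (al - be)) (fun t s => - 1 * ((l - t) * sin (s * be) * be))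
  (fun t s => - 1 * ((l - t) * cos (s * be) * be)) (fun _ _ => al - be) l).
- exact: cvg_within.
- move=> t s; split; [exact: joint_continuous_mul (jl _ _) (cs _ _)
    |exact: joint_continuous_mul (jc _ _ _) (joint_continuous_mul (jl _ _) (sn _ _))|exact: joint_continuous_loop_phi].
- move=> t s; split; last exact: jc.
    by apply: joint_continuous_mul (jc _ _ _) _; apply: joint_continuous_mul (jc _ _ _);
      exact: joint_continuous_mul (jl _ _) (sn _ _).
  by apply: joint_continuous_mul (jc _ _ _) _; apply: joint_continuous_mul (jc _ _ _);
      exact: joint_continuous_mul (jl _ _) (cs _ _).
- near=> t => s /=; rewrite !vec3E mulN1r sqrrN !exprMn -mulrDr cos2Dsin2 mulr1.
  have tl : `|l - t| < l by near: t; apply/nbhs_normP; exists l.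
  by rewrite -[(l - t) ^+ 2]real_normK ?num_real// ltr_pXn2r ?nnegrE ?(ltW l0)//.
- near=> t => s; rewrite -Eq -Ed.
  have tl : 0 < t < l.
    by apply/andP; split; near: t; [exact: nbhs_left_gt|exact: nbhs_left_lt].
  rewrite (pol South _ _ (loop_domain phi0 al be s tl)).
  by rewrite (@derive_val _ _ _ _ _ _ _ (is_derive_south _ _ _)).
- by move=> s; split; congr vec3; ring.
Unshelve. all: by end_near. Qed.

Lemma periodic_eq_angle (T : Type) (f : R -> T) (x y : R) :
  (forall x, f (x + 2 * pi) = f x) -> eq_angle x y -> f x = f y.
Proof.
move=> pf [k ->]; have nat_case (n : nat) z : f (z + 2 * pi * n%:R) = f z.
  elim: n => [|n IH]; first by rewrite mulr0 addr0.
  by rewrite -[n.+1%:R]natr1 mulrDr mulr1 addrA pf.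
case: k => n; first by rewrite -pmulrn.
rewrite -(nat_case n.+1 (x + 2 * pi * (Negz n)%:~R)); congr f.
by rewrite NegzE rmorphN /= -pmulrn; ring.
Qed.

(** [smooth_form1] requires periodicity in the cap charts only. In the North chart a full turn of
    phi and a full turn of theta both amount to adding 2 pi to chi, so periodicity in the two polar
    angles follows from there. *)
Lemma polar_periodic (t x y x' y' : R) v : 0 < t < l ->
  eq_angle x x' -> eq_angle y y' ->
  a Polar (vec3 t x y) v = a Polar (vec3 t x' y') v.
Proof.
move=> tl; have [_ _ pol per] := sa; have [t0 tl'] := andP tl.
have dom z w : chart_domain l North (from_polar l North (vec3 t z w)).
  rewrite /= !vec3E !exprMn -mulrDr cos2Dsin2 mulr1 ltr_pXn2r// ?nnegrE ltW//.
  exact: lt_trans tl'.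
have E z w : a Polar (vec3 t z w) v =
    a North (from_polar l North (vec3 t z w)) (dpolar (vec3 t z w) v).
  rewrite (pol North) /=; last by rewrite vec3E.
  by rewrite (@derive_val _ _ _ _ _ _ _ (is_derive_north _ _ _)).
have cp (z : R) : cos (z + 2 * pi) = cos z by rewrite mulr_natl cosD2pi.
have sp (z : R) : sin (z + 2 * pi) = sin z by rewrite mulr_natl sinD2pi.
move=> hx hy; transitivity (a Polar (vec3 t x' y) v).
  apply: (@periodic_eq_angle _ (fun x => a Polar (vec3 t x y) v)) hx => z.
  rewrite !E -[in RHS]per//; congr (a North _ _); last first.
    by rewrite /dpolar !vec3E.
  by apply: row3P; rewrite ![in RHS]mxE /from_polar !vec3E /=; ring.
apply: (@periodic_eq_angle _ (fun y => a Polar (vec3 t x' y) v)) hy => z.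
rewrite !E -[in RHS]per//; congr (a North _ _); last first.
  by rewrite /dpolar !vec3E cp sp.
by apply: row3P; rewrite ![in RHS]mxE /from_polar !vec3E /= ?cp ?sp; ring.
Qed.

End loops.

Lemma omega_loop (R : realType) (g : R -> R) (m phi0 al be t s : R) : smooth g ->
  omega g m (loop phi0 al be t s) (vec3 1 0 0) (vec3 0 al be) =
  m * (al + be * derive1 g t) * sin (phi0 + s * al) - be * g t.
Proof.
move=> sg; rewrite /omega /ext_deriv /area_form !derive_lambda_form// /loop !vec3E.
by ring.
Qed.

Lemma cvg_constant (R : realType) (F : set_system R) (f : R -> R) (c L : R) :
  ProperFilter F -> (\forall x \near F, f x = c) -> f x @[x --> F] --> L -> c = L.
Proof.
move=> FF fc fL; apply: (cvg_unique _ _ fL) => //.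
by apply: cvg_near_cst.
Qed.

(* The loop in the direction of theta and the loop in the direction of phi both
   shrink to the fibre over each pole; over the pole t = l they do so with
   opposite orientations, which determines the integral over that fibre. *)
Lemma loop_integral_theta (R : realType) (g : R -> R) (l m : R) (a : form1 R)
    (phi0 w T t : R) :
  0 < l -> 0 < T -> w * T = 2 * pi \/ w * T = - (2 * pi) ->
  smooth g -> g 0 = 0 -> g l = 0 -> antiderivative g l = 2 ->
  primitive_of_omega l g m a -> 0 < t < l ->
  loop_integral a phi0 0 w T t =
    w * T * (1 + m * g t * sin phi0 - antiderivative g t).
Proof.
move=> l0 T0 wT sg g0 gl Gl [sa da] tl.
have angle (x : R) : eq_angle (x + T * w) x.
  rewrite mulrC; case: wT => ->; [exists (-1)|exists 1].
    by rewrite rmorphN1; ring.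
  by rewrite rmorph1; ring.
have W0 : w != 0.
  by apply/eqP => w0; move: wT (pi_gt0 R); rewrite w0 mul0r; lra.
pose J := loop_integral a phi0 0 w T.
pose F t := J t - w * T * (m * g t * sin phi0 - antiderivative g t).
(* Along the loop in phi, omega paired with d/dt is m w sin phi, whose integral over a full turn
   vanishes. *)
pose P := loop_integral a phi0 w 0 T.
have dP x : 0 < x < l -> is_derive x 1 P 0.
  move=> xl; pose W s := - m * cos (phi0 + s * w).
  have dW (s : R) : is_derive s 1 W
      (omega g m (loop phi0 w 0 x s) (vec3 1 0 0) (vec3 0 w 0)).
    rewrite omega_loop//.
    have d1 := is_derive_add (is_derive_cst phi0 s 1) (is_derive_mulr w s).
    have d2 := @is_derive_comp _ (@cos R) _ _ _ _ (is_derive_cos _) d1.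
    by apply: is_derive_eq (is_derive_cmul (- m) d2) _; rewrite /cst; ring.
  have := is_derive_loop_integral sa T0 xl da dW.
  have -> : W T - W 0 = 0.
    rewrite /W mul0r addr0.
    rewrite (@periodic_eq_angle _ _ (@cos R) _ _ _ (angle phi0)) ?subrr// => z.
    by rewrite mulr_natl cosD2pi.
  apply; rewrite /loop; apply: (polar_periodic sa) => //.
    by rewrite mul0r addr0; exact: angle.
  by rewrite !mulr0; exact: eq_angle_refl.
have dF x : 0 < x < l -> is_derive x 1 F 0.
  move=> xl; pose W s := (m * (w * derive1 g x) * sin phi0 - w * g x) * s.
  have dW (s : R) : is_derive s 1 W
      (omega g m (loop phi0 0 w x s) (vec3 1 0 0) (vec3 0 0 w)).
    by rewrite omega_loop// mulr0 addr0 add0r; exact: is_derive_mull.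
  have dJ : is_derive x 1 J (W T - W 0).
    have := is_derive_loop_integral sa T0 xl da dW; apply.
    rewrite /loop; apply: (polar_periodic sa) => //.
      by rewrite !mulr0; exact: eq_angle_refl.
    by move: (angle 0); rewrite mul0r addr0.
  have dg := is_derive_mul (is_derive_cmul m (smooth_is_derive1 x sg))
    (is_derive_cst (sin phi0) x 1).
  have dN := is_derive_antiderivative x sg.
  apply: is_derive_eq (is_derive_sub dJ (is_derive_cmul (w * T) (is_derive_sub dg dN))) _.
  by rewrite /W /cst /=; ring.
have near0 c (f : R -> R) : (forall x, 0 < x < l -> f x = c) ->
    \forall x \near 0^'+, f x = c.
  move=> fc; near=> x; apply: fc.
  by apply/andP; split; near: x; [exact: nbhs_right_gt|exact: nbhs_right_lt].
have nearl c (f : R -> R) : (forall x, 0 < x < l -> f x = c) ->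
    \forall x \near l^'-, f x = c.
  move=> fc; near=> x; apply: fc.
  by apply/andP; split; near: x; [exact: nbhs_left_gt|exact: nbhs_left_lt].
have cF x : 0 < x < l -> F x = F t by move=> xl; exact: is_derive0_constant_oo dF _ _ xl tl.
have cP x : 0 < x < l -> P x = P t by move=> xl; exact: is_derive0_constant_oo dP _ _ xl tl.
pose S x := w * T * (m * g x * sin phi0 - antiderivative g x).
have cS : continuous S.
  move=> x; have dg := is_derive_mul (is_derive_cmul m (smooth_is_derive1 x sg))
    (is_derive_cst (sin phi0) x 1).
  exact: is_derive_continuous (is_derive_cmul (w * T)
    (is_derive_sub dg (is_derive_antiderivative x sg))).
have capN al be : loop_integral a phi0 al be T x @[x --> 0^'+] -->
    axis_integral a North phi0 (al + be) T by exact: (loop_integral_north sa).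
have capS al be : loop_integral a phi0 al be T x @[x --> l^'-] -->
    axis_integral a South (phi0 + pi) (al - be) T by exact: (loop_integral_south sa).
have FN : F t = axis_integral a North phi0 (0 + w) T - S 0.
  apply: (@cvg_constant _ 0^'+ F) (near0 _ _ cF) _.
  have cS0 : S x @[x --> 0^'+] --> S 0 by apply: cvg_at_right_filter; exact: cS.
  exact: cvgB (capN 0 w) cS0.
have FS : F t = axis_integral a South (phi0 + pi) (0 - w) T - S l.
  apply: (@cvg_constant _ l^'- F) (nearl _ _ cF) _.
  have cS0 : S x @[x --> l^'-] --> S l by apply: cvg_at_left_filter; exact: cS.
  exact: cvgB (capS 0 w) cS0.
have PN : P t = axis_integral a North phi0 (w + 0) T.
  by apply: (@cvg_constant _ 0^'+ P) (near0 _ _ cP) _; exact: (capN w 0).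
have PS : P t = axis_integral a South (phi0 + pi) (w - 0) T.
  by apply: (@cvg_constant _ l^'- P) (nearl _ _ cP) _; exact: (capS w 0).
(* Replacing s by T - s turns one traversal of the fibre into the other up to the full turn w T,
   which B does not see; the velocity changes sign. *)
have refl : axis_integral a South (phi0 + pi) (0 - w) T =
    - axis_integral a South (phi0 + pi) (w - 0) T.
  have [_ sm _ per] := sa.
  pose B (s : R) := a South (vec3 0 0 (phi0 + pi + s * w)) (vec3 0 0 1).
  have cB : continuous B.
    move=> s; pose H p := a South p (vec3 0 0 1).
    have cv : (fun s => vec3 0 0 (phi0 + pi + s * w)) @ s --> vec3 0 0 (phi0 + pi + s * w).
      apply: cvg_vec3; [exact: cvg_cst|exact: cvg_cst|exact: affine_continuous].
    have cH : {for vec3 0 0 (phi0 + pi + s * w), continuous H}.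
      have [|] := sm South (vec3 0 0 1) [::] (vec3 0 0 (phi0 + pi + s * w)) _ => //=.
      by rewrite !vec3E expr0n /= addr0 exprn_gt0.
    exact: cvg_comp _ _ cv cH.
  have intB (f : R -> R) : continuous f ->
     lebesgue_measure.-integrable `[0, T] (EFin \o f).
    by move=> cf; apply: continuous_integrable_itv => s _; exact: cf.
  have cBT : continuous (fun s => B (T - s)).
    move=> s; apply: (@continuous_comp _ _ _ (fun s => T - s) B); last exact: cB.
    exact: is_derive_continuous (is_derive_csub T s).
  have -> : axis_integral a South (phi0 + pi) (w - 0) T =
      w * \int[lebesgue_measure]_(s in `[0, T]) B s.
    rewrite /axis_integral subr0; apply: RintegralZl => //; exact: intB.
  rewrite -mulNr -(Rintegral_reflect (ltW T0) cB) -RintegralZl//; last exact: intB.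
  rewrite /axis_integral sub0r.
  apply: eq_Rintegral => s _; congr (_ * _); rewrite /B.
  apply: (@periodic_eq_angle _ _ (fun z => a South (vec3 0 0 z) (vec3 0 0 1))).
    move=> z; rewrite -[RHS]per//=; last by rewrite !vec3E expr0n /= addr0 exprn_gt0.
    by congr (a South _ _); apply: row3P; rewrite ![in RHS]mxE !vec3E /=; ring.
  apply: eq_angle_sym; rewrite (_ : _ + _ = phi0 + pi + s * - w + T * w); last by ring.
  exact: angle.
(* At t = 0 the correction S vanishes, so F = P. At t = l the fibre is reversed and S(l) = - 2 w T,
   so F = - P + 2 w T. Adding the two gives F = w T. *)
have wTE : F t = w * T.
  move: FN FS; rewrite refl /S g0 gl Gl antiderivative0 add0r -[X in axis_integral _ North _ X]addr0.
  by rewrite -PN -PS => h1 h2; lra.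
by move: wTE; rewrite /F -/J => h; lra.
Unshelve. all: by end_near. Qed.

(** * The unit tangent bundle and the latitude orbit *)

Lemma cos1_eq_angle (R : realType) (x : R) : cos x = 1 -> eq_angle 0 x.
Proof.
(* The integer k counts the turns that bring x into [- pi, pi[. The absolute value of the remainder
   y lies in [0, pi], where cos is injective. *)
move=> cx; have p0 := pi_gt0 R; pose k := Num.floor ((x + pi) / (2 * pi)).
pose y := x - 2 * pi * k%:~R.
have xy : eq_angle y x by exists k; rewrite /y subrK.
have cy : cos `|y| = 1.
  rewrite cos_norm (@periodic_eq_angle _ _ (@cos R) _ _ _ xy)// => z.
  by rewrite mulr_natl cosD2pi.
have y0 : `|y| = 0.
  apply: cos_inj; rewrite ?cos0 ?cy// in_itv/= ?lexx ?pi_ge0// normr_ge0 /=.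
  have /andP[h1 h2] := floor_itv ((x + pi) / (2 * pi)).
  move: h1 h2; rewrite -/k intrD1 ler_pdivlMr ?ltr_pdivrMr ?mulr_gt0// => h1 h2.
  rewrite ler_norml /y; apply/andP; split; nra.
by move: xy; move/normr0_eq0: y0 => ->.
Qed.

Lemma sincos_eq_angle (R : realType) (x y : R) :
  cos x = cos y -> sin x = sin y -> eq_angle x y.
Proof.
move=> cxy sxy; have [k hk] : eq_angle 0 (y - x).
  by apply: cos1_eq_angle; rewrite cosB cxy sxy -!expr2 cos2Dsin2.
by exists k; rewrite -[LHS](subrK x) hk; ring.
Qed.

Lemma eq_angle_sin (R : realType) (x y : R) : eq_angle x y -> sin x = sin y.
Proof. by apply: periodic_eq_angle => z; rewrite mulr_natl sinD2pi. Qed.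

Lemma eq_angle_cos (R : realType) (x y : R) : eq_angle x y -> cos x = cos y.
Proof. by apply: periodic_eq_angle => z; rewrite mulr_natl cosD2pi. Qed.

Lemma uvecP (R : realType) (l : R) (p q : 'rV[R]_3) :
  uvec l p = uvec l q <-> same_vector l p q.
Proof.
split=> [h|h].
  by have /eqmodP/asboolP : (p = q %[mod (SS l)])%qT by exact: h.
by apply/eqmodP/asboolP.
Qed.

Lemma uvec_repr (R : realType) (l : R) (z : SS l) : uvec l (repr z) = z.
Proof. exact: reprK. Qed.

Lemma clamp_id (R : realType) (l t : R) : 0 <= t <= l -> clamp l t = t.
Proof. by move=> /andP[t0 tl]; rewrite /clamp min_l// max_r. Qed.

Lemma clamp_inner (R : realType) (l t x : R) : 0 < t < l -> clamp l x = t -> x = t.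
Proof.
move=> /andP[t0 tl]; rewrite /clamp /Num.max /Num.min.
by case: (ltP x l) => h1; case: (ltP 0 _) => h2 e; lra.
Qed.

Lemma latitude_uvec (R : realType) (l : R) (p : 'rV[R]_3) :
  latitude (uvec l p) = clamp l (co0 p).
Proof. by have /uvecP[] := uvec_repr (uvec l p). Qed.

Lemma inner_uvecP (R : realType) (l : R) (p q : 'rV[R]_3) : 0 < co0 p < l ->
  uvec l p = uvec l q <->
  [/\ co0 p = co0 q, eq_angle (co1 p) (co1 q) & eq_angle (co2 p) (co2 q)].
Proof.
move=> pl; have [p0 p1] := andP pl; have cl : clamp l (co0 p) = co0 p.
  by apply: clamp_id; rewrite !ltW.
rewrite uvecP /same_vector cl gt_eqF// lt_eqF//; split=> [[h []]|[<- h1 h2]].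
  by rewrite [co0 q](clamp_inner pl).
by split.
Qed.

Lemma inner_repr (R : realType) (l : R) (z : SS l) : 0 < latitude z < l ->
  co0 (repr z) = latitude z.
Proof. by move=> zl; exact: (clamp_inner zl). Qed.

Lemma chart_at_inner (R : realType) (l : R) (z : SS l) :
  0 < latitude z < l -> chart_at z = Polar.
Proof. by move=> /andP[z0 zl]; rewrite /chart_at gt_eqF// lt_eqF. Qed.

Lemma coordinates_polar (R : realType) (l : R) (z : SS l) (q : 'rV[R]_3) :
  coordinates Polar z q <-> 0 < co0 q < l /\ z = uvec l q.
Proof.
split=> [[/= h [p [_ -> qp]]]|[h ->]]; first by split=> //; rewrite qp.
split=> //=; exists q; split=> //.
by have [h0 h1] := andP h; rewrite /in_strip !ltW.
Qed.

Lemma contract_form_inner (R : realType) (l : R) (a : form1 R) (X : vfield R)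
    (z : SS l) : 0 < latitude z < l ->
  exists q, [/\ uvec l q = z, 0 < co0 q < l & contract_form a X z = a Polar q (X Polar q)].
Proof.
move=> zl; rewrite /contract_form chart_at_inner//.
have /coordinates_polar[h1 h2] : coordinates Polar z (get (coordinates Polar z)).
  apply: getPex; exists (repr z); apply/coordinates_polar.
  by rewrite inner_repr// uvec_repr.
by eexists; split; [symmetry; exact: h2| exact: h1|].
Qed.

Lemma preimage_uvec_open (R : realType) (l : R) (f : R -> 'rV[R]_3) (U : set (SS l)) :
  continuous f -> (forall s, in_strip l (f s)) -> SSopen U ->
  open [set s | U (uvec l (f s))].
Proof.
move=> cf fl [V oV UV]; have -> : [set s | U (uvec l (f s))] = f @^-1` V.
  by apply/seteqP; split=> s /=; move/(UV _ (fl s)).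
by apply: open_comp => // s _; exact: cf.
Qed.

(** * The latitude as a periodic orbit of the magnetic field *)

Section orbit.
Variables (R : realType) (l : R) (g : R -> R) (t0 : R).
Hypotheses (hg : profile l g) (ht0 : 0 < t0 < l) (hdg : derive1 g t0 != 0).

Let m : R := `|g t0 / derive1 g t0|.
Let X := magnetic_field g m.
Let eps : R := Num.sg (derive1 g t0).
Let phi0 : R := eps * (pi / 2).
Let w : R := (derive1 g t0)^-1.
Let T : R := 2 * pi * `|derive1 g t0|.

(** Unit vectors tangent to a latitude have phi = pi / 2 or - pi / 2, and eps selects the prescribed
    orientation. T = 2 pi / |w| is the time of one turn. *)
Definition latitude_orbit (s : R) : SS l := uvec l (vec3 t0 phi0 (0 + s * w)).

Lemma profile_t0_gt0 : 0 < g t0.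
Proof. by have [_ [_ _ gp] _ _ _] := hg; exact: gp. Qed.

Lemma smooth_profile : smooth g.
Proof. by have [[_ sg] _ _ _ _] := hg. Qed.

Lemma sgr_derive1_sqr : eps * eps = 1.
Proof. by rewrite /eps -expr2 sqr_sg hdg. Qed.

Lemma sgr_derive1_inv : eps^-1 = eps.
Proof.
have e0 : eps != 0 by rewrite sgr_eq0.
by apply: (mulfI e0); rewrite mulfV// sgr_derive1_sqr.
Qed.

Lemma orbit_speedE : m = eps * g t0 * w.
Proof.
rewrite /m normrM normrV ?unitfE// (ger0_norm (ltW profile_t0_gt0)) normrEsg -/eps invfM.
by rewrite sgr_derive1_inv /w; ring.
Qed.

Lemma sin_phi0 : sin phi0 = eps.
Proof. by rewrite /phi0 sin_sg sin_pihalf mulr1. Qed.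

Lemma cos_phi0 : cos phi0 = 0.
Proof. by rewrite /phi0 cos_sg// cos_pihalf. Qed.

Lemma orbit_period_gt0 : 0 < T.
Proof. by rewrite /T !mulr_gt0 ?pi_gt0 ?normr_gt0. Qed.

Lemma angular_speed_period : w * T = 2 * pi \/ w * T = - (2 * pi).
Proof.
have wTE : w * T = 2 * pi * eps.
  by rewrite /T normrEsg -/eps /w; field.
rewrite wTE /eps; case: (ltgtP (derive1 g t0) 0) => h.
- by right; rewrite ltr0_sg//; ring.
- by left; rewrite gtr0_sg//; ring.
- by move: hdg; rewrite h eqxx.
Qed.

(** The phi-component of m X + V on these vectors is 1 - m eps g'(t0) / g(t0). The value of m is the
    one that makes it vanish, so the curve stays on its latitude. *)
Lemma magnetic_field_t0 (q : 'rV[R]_3) : co0 q = t0 -> eq_angle (co1 q) phi0 ->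
  X Polar q = vec3 0 0 w.
Proof.
move=> q0 qphi; have sq := eq_angle_sin qphi; have cq := eq_angle_cos qphi.
have g0 := profile_t0_gt0.
rewrite /X /magnetic_field /geodesic_field /fibre_rotation q0 sq cq sin_phi0 cos_phi0.
have e2 := sgr_derive1_sqr.
apply: row3P; rewrite !mxE /= orbit_speedE /w.
- by ring.
- transitivity (1 - eps * eps); last by rewrite e2 subrr.
  by field; rewrite hdg gt_eqF.
- transitivity (eps * eps * (derive1 g t0)^-1); last by rewrite e2 mul1r.
  by field; rewrite hdg gt_eqF.
Qed.

Lemma latitude_latitude_orbit s : latitude (latitude_orbit s) = t0.
Proof. by rewrite latitude_uvec vec3E clamp_id//; have [h0 h1] := andP ht0; rewrite !ltW. Qed.

(** An angle with sine eps = 1 or - 1 has cosine 0 and is determined modulo 2 pi. The orbit is thus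
    cut out by two closed equations, which do not depend on the representative. The time for
    longitude theta is theta / w. *)
Lemma latitude_orbitP (p : 'rV[R]_3) : in_strip l p ->
  (exists s, uvec l p = latitude_orbit s) <-> co0 p = t0 /\ sin (co1 p) = eps.
Proof.
move=> pl; split=> [[s]|[p0 p1]].
  move=> /esym/inner_uvecP; rewrite !vec3E => /(_ ht0)[-> h _].
  by rewrite -(eq_angle_sin h) sin_phi0.
exists (co2 p * derive1 g t0); apply/inner_uvecP; rewrite ?p0// !vec3E; split=> //.
  apply: sincos_eq_angle; rewrite ?sin_phi0 ?cos_phi0//.
  apply: sin1cos0; rewrite p1 /eps; rewrite normr_sg hdg//.
by rewrite add0r /w mulfK//; exact: eq_angle_refl.
Qed.

Lemma latitude_orbit_continuous : continuous (fun s : R => vec3 t0 phi0 (0 + s * w)).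
Proof.
by move=> s; apply: cvg_vec3; [exact: cvg_cst|exact: cvg_cst|exact: affine_continuous].
Qed.

Lemma latitude_orbit_periodic s : latitude_orbit (s + T) = latitude_orbit s.
Proof.
apply/inner_uvecP; rewrite !vec3E//; split=> //; first exact: eq_angle_refl.
rewrite mulrDl [T * w]mulrC; case: angular_speed_period => ->; [exists (-1)|exists 1].
  by rewrite rmorphN1; ring.
by rewrite rmorph1; ring.
Qed.

Lemma latitude_orbit_integral_curve : integral_curve X latitude_orbit.
Proof.
move=> s; rewrite chart_at_inner ?latitude_latitude_orbit//=.
exists (fun u => vec3 t0 phi0 (0 + u * w)); split.
  by apply: (@filterE _ (nbhs s)) => u; apply/coordinates_polar; rewrite vec3E.
rewrite magnetic_field_t0 ?vec3E//; last exact: eq_angle_refl.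
apply: is_derive_vec3.
by apply: is_derive_eq (is_derive_add (is_derive_cst (0 : R) s 1) (is_derive_mulr w s)) _; rewrite add0r.
Qed.

Lemma latitude_orbit_periodic_orbit : periodic_orbit X latitude_orbit T.
Proof.
split; [exact: orbit_period_gt0|exact: latitude_orbit_integral_curve|exact: latitude_orbit_periodic].
Qed.

Lemma range_latitude_orbit : range latitude_orbit =
  velocity_lift l g (fun=> t0) (fun s => Num.sg (derive1 g t0) * s / g t0).
Proof.
have g0 := profile_t0_gt0.
have d1 (s : R) : derive1 (fun=> t0) s = 0 by rewrite derive1_cst.
have d2 (s : R) : derive1 (fun s => eps * s / g t0) s = eps / g t0.
  rewrite derive1E; apply: (@derive_val _ _ _ _ _ _ _ _).
  have h := is_derive_mul (is_derive_mull eps s) (is_derive_cst (g t0)^-1 s 1).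
  by apply: is_derive_eq h _; rewrite mulr0 addr0.
apply/seteqP; split=> [z [s _ <-]|z [s [phi [-> ]]]].
  (* The orbit runs at speed m = eps g(t0) w, the lift at unit speed; the parameter is therefore m
     s. *)
  exists (eps * g t0 * (s * w)), phi0; rewrite d1 d2 cos_phi0 sin_phi0; split=> //.
  apply/inner_uvecP; rewrite !vec3E//; split=> //; first exact: eq_angle_refl.
  rewrite -/eps (_ : eps * _ / _ = eps * eps * (s * w)); last by field; rewrite gt_eqF.
  by rewrite sgr_derive1_sqr mul1r add0r; exact: eq_angle_refl.
rewrite d1 d2 => cphi sphi.
have : in_strip l (vec3 t0 phi (eps * s / g t0)).
  by rewrite /in_strip vec3E; have [h0 h1] := andP ht0; rewrite !ltW.
move=> /latitude_orbitP[_]; rewrite !vec3E => h; case: h => [|u hu].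
  split=> //; move: sphi => /(congr1 ( *%R^~ (g t0))).
  by rewrite !divfK ?gt_eqF.
by exists u.
Qed.

End orbit.

(** * Invariant measures carried by a closed curve *)

Section negligible_modification.
Local Open Scope ereal_scope.
Context d (Y : measurableType d) (R : realType) (mu : {measure set Y -> \bar R}).
Variables (N : set Y) (mN : measurable N) (muN : mu N = 0).

Import HBNNSimple.

(** A simple function below f, set to 0 on N, lies below h and keeps its integral; the claim follows
    by taking suprema over simple functions. *)
Let ge0_le (f h : Y -> \bar R) : (forall x, 0 <= f x) -> (forall x, 0 <= h x) ->
  (forall x, ~ N x -> f x = h x) -> \int[mu]_x f x <= \int[mu]_x h x.
Proof.
move=> f0 h0 fh; rewrite !ge0_integralTE//.
apply: ge_ereal_sup => _ [k kf <-].
apply: ereal_sup_ubound; exists (proj_nnsfun k (measurableC mN)).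
  move=> x /=; rewrite mindicE; have [Nx|Nx] := pselect (N x).
    by rewrite memNset ?mulr0// => /(_ Nx).
  by rewrite mem_set// mulr1 -fh.
rewrite -!integralT_nnsfun; apply: ge0_ae_eq_integral => //.
- by apply/measurable_EFinP; exact: measurable_funP.
- by apply/measurable_EFinP; exact: measurable_funP.
- by move=> x _; rewrite lee_fin.
- by move=> x _; rewrite lee_fin.
- exists N; split=> // x /= hx; apply: contrapT => Nx; apply: hx => _.
  by rewrite mindicE mem_set// mulr1.
Qed.

(* The function f need not be measurable: this spares proving that
   contract_form is measurable at the poles. *)
Lemma integral_negligible_modification (f h : Y -> \bar R) :
  (forall x, ~ N x -> f x = h x) -> \int[mu]_x f x = \int[mu]_x h x.
Proof.
move=> fh.
have E (u v : Y -> \bar R) : (forall x, 0 <= u x) -> (forall x, 0 <= v x) ->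
    (forall x, ~ N x -> u x = v x) -> \int[mu]_x u x = \int[mu]_x v x.
  by move=> u0 v0 uv; apply/eqP; rewrite eq_le !ge0_le// => x Nx; rewrite uv.
rewrite integralE [RHS]integralE; congr (_ - _); apply: E => // x Nx.
- by rewrite !funeposE fh.
- by rewrite !funenegE fh.
Qed.

End negligible_modification.

Section curve_measure.
Context d (Y : measurableType d) (R : realType) (T : R) (T0 : 0 < T).
Variable c : {mfun measurableTypeR R >-> Y}.

Definition curve_measure : probability Y R := distribution (uniform_prob T0) c.

Lemma curve_measureE (A : set Y) : measurable A ->
  curve_measure A = ((T^-1)%:E * lebesgue_measure (`[0%R, T] `&` c @^-1` A))%E.
Proof.
move=> mA; have mcA : measurable (c @^-1` A).
  by rewrite -[X in measurable X]setTI; exact: measurable_funP.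
rewrite /curve_measure /distribution /pushforward /= /uniform_prob integral_uniform_pdf.
rewrite (eq_integral (fun=> (T^-1)%:E)); last first.
  move=> x; rewrite inE /= in_itv/= => -[_ hx].
  by rewrite /uniform_pdf hx subr0.
rewrite integral_cst//; last exact: measurableI.
by rewrite setIC.
Qed.

Lemma integral_curve_measure (f : Y -> R) : measurable_fun setT f ->
  (forall s : R, {for s, continuous (fun s : R => f (c s))}) ->
  \int[curve_measure]_y f y = T^-1 * \int[lebesgue_measure]_(s in `[0, T]) f (c s).
Proof.
move=> mf cfc; rewrite /Rintegral.
have mfE : measurable_fun setT (EFin \o f) by exact/measurable_EFinP.
have pe (h : Y -> \bar R) : measurable_fun setT h -> (forall y, 0 <= h y)%E ->
   (\int[curve_measure]_y h y =
    (T^-1)%:E * \int[lebesgue_measure]_(s in `[0%R, T]) h (c s))%E.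
  move=> mh h0; rewrite /curve_measure /distribution.
  rewrite (ge0_integral_pushforward (phi := c))//.
  rewrite preimage_setT integral_uniform//.
  - by rewrite subr0.
  - exact: measurableT_comp.
  - by move=> x /=.
have int : lebesgue_measure.-integrable `[0, T] (EFin \o (fun s => f (c s))).
  by apply: continuous_integrable_itv => s _; exact: cfc.
rewrite integralE [X in _ = _ * fine X]integralE !pe//; last 2 first.
- exact: measurable_funeneg.
- exact: measurable_funepos.
have p1 := integrable_pos_fin_num _ int; have n1 := integrable_neg_fin_num _ int.
have {}p1 := p1 (measurable_itv _); have {}n1 := n1 (measurable_itv _).
set p := (\int[_]_(_ in _) _)%E in p1; set n := (\int[_]_(_ in _) _)%E in n1.
rewrite -[RHS]/(T^-1 * fine (p - n)%E).
have -> : (\int[lebesgue_measure]_(s in `[0%R, T]) (fun x => (f x)%:E)^\+ (c s))%E = p.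
  by apply: eq_integral => s _; rewrite !funeposE.
have -> : (\int[lebesgue_measure]_(s in `[0%R, T]) (fun x => (f x)%:E)^\- (c s))%E = n.
  by apply: eq_integral => s _; rewrite !funenegE.
by rewrite -(fineK p1) -(fineK n1) -!EFinM -!EFinB /= mulrBr.
Qed.

End curve_measure.

(** Half-open periods can be cut and reassembled without overlap. *)
Lemma lebesgue_measure_itv_co (R : realType) (T : R) (A : set (measurableTypeR R)) :
  0 < T -> measurable A ->
  lebesgue_measure (`[0, T]%classic `&` A) = lebesgue_measure (`[0, T[%classic `&` A).
Proof.
move=> T0 mA; apply/eqP; rewrite eq_le; apply/andP; split; last first.
  apply: le_measure; rewrite ?inE; [exact: measurableI|exact: measurableI|].
  by move=> x /= []; rewrite !in_itv/= => /andP[-> /ltW ->].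
have sub : `[0, T]%classic `&` A `<=` (`[0, T[%classic `&` A) `|` [set T].
  move=> x /= []; rewrite !in_itv/= => /andP[-> ]; rewrite le_eqVlt.
  by move=> /predU1P[->|->]; [right|left].
have mU : measurable ((`[0, T[%classic `&` A) `|` [set T] : set (measurableTypeR R)).
  by apply: measurableU => //; exact: measurableI.
have mI := measurableI _ _ (@measurable_itv R `[0, T]) mA.
have mJ := measurableI _ _ (@measurable_itv R `[0, T[) mA.
have h1 : (lebesgue_measure (`[0%R, T] `&` A) <=
    lebesgue_measure ((`[0%R, T[ `&` A) `|` [set T]))%E.
  by apply: le_measure; rewrite ?inE.
apply: (le_trans h1).
have h2 := measureU2 lebesgue_measure mJ (measurable_set1 T).
apply: (le_trans h2); rewrite [X in (_ + X)%E](_ : _ = 0%E) ?adde0//.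
exact: lebesgue_measure_set1.
Qed.

(** By periodicity s may be replaced by its remainder r modulo T. The translation by r then carries
    [0, T - r[ onto [r, T[, and the translation by r - T carries [T - r, T[ onto [0, r[. *)
Lemma lebesgue_measure_periodic_shift (R : realType) (T s : R)
    (B : set (measurableTypeR R)) :
  0 < T -> measurable B -> (forall u, B (u + T) <-> B u) ->
  lebesgue_measure (`[0, T]%classic `&` [set u | B (u + s)]) =
  lebesgue_measure (`[0, T]%classic `&` B).
Proof.
move=> T0 mB pB.
have mS (r : R) (A : set (measurableTypeR R)) : measurable A ->
    measurable [set u : measurableTypeR R | A (u + r)].
  move=> mA; have mf : measurable_fun [set: measurableTypeR R]
      ((fun u => u + r) : measurableTypeR R -> measurableTypeR R).
    by apply: measurable_funD => //; exact: measurable_id.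
  by have := mf measurableT _ mA; rewrite setTI.
have pBn (n : nat) u : B (u + T * n%:R) <-> B u.
  elim: n => [|n IH]; first by rewrite mulr0 addr0.
  by rewrite -[n.+1%:R]natr1 mulrDr mulr1 addrA pB.
have pBz (k : int) u : B (u + T * k%:~R) <-> B u.
  case: k => n; first exact: pBn.
  rewrite -(pBn n.+1) NegzE rmorphN /= -pmulrn.
  by rewrite (_ : _ + _ + _ = u)//; ring.
pose k := Num.floor (s / T); pose r := s - T * k%:~R.
have /andP[r0 rT] : 0 <= r < T.
  have /andP[h1 h2] := floor_itv (s / T).
  move: h1 h2; rewrite -/k intrD1 ler_pdivlMr// ltr_pdivrMr// /r => h1 h2.
  by apply/andP; split; nra.
have -> : [set u | B (u + s)] = [set u | B (u + r)].
  apply/seteqP; split=> u /=; rewrite (_ : u + s = u + r + T * k%:~R);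
    by [move/pBz|rewrite /r; ring|move=> h; apply/pBz].
rewrite !lebesgue_measure_itv_co//; last exact: mS.
have split_at (x : R) (A : set (measurableTypeR R)) : 0 <= x <= T -> measurable A ->
    lebesgue_measure (`[0, T[%classic `&` A) =
    (lebesgue_measure (`[0%R, x[%classic `&` A) + lebesgue_measure (`[x, T[%classic `&` A))%E.
  move=> /andP[x0 xT] mA; rewrite -measureU; [|exact: measurableI|exact: measurableI|].
  - congr (lebesgue_measure _); apply/seteqP; split=> y /=.
      move=> [yI Ay]; move: yI; rewrite !in_itv/= => /andP[y0 yT].
      by have [yx|yx] := ltP y x; [left|right]; rewrite ?y0 ?yT ?yx.
    by move=> [] [yI Ay]; move: yI; rewrite !in_itv/= => /andP[y0 yT]; split=> //;
      apply/andP; split; lra.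
  - rewrite -subset0 => y /= [[]]; rewrite !in_itv/= => /andP[_ y1] _ [/andP[y2 _] _].
    by move: (lt_le_trans y1 y2); rewrite ltxx.
rewrite (split_at (T - r)); [|by apply/andP; split; lra|exact: mS].
rewrite [RHS](split_at r) ?r0 ?(ltW rT)// addeC; congr (_ + _)%E.
- rewrite -[RHS](lebesgue_measure_shift (r - T)); last exact: measurableI.
  congr (lebesgue_measure _); apply/seteqP; split=> u /=; rewrite !in_itv/=.
    move=> [/andP[h1 h2] h3]; split; first by apply/andP; split; lra.
    by apply/pB; rewrite (_ : u + (r - T) + T = u + r)//; ring.
  move=> [/andP[h1 h2] /pB h3]; split; first by apply/andP; split; lra.
  by move: h3; rewrite (_ : u + (r - T) + T = u + r)//; ring.
- rewrite -[RHS](lebesgue_measure_shift r); last exact: measurableI.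
  congr (lebesgue_measure _); apply/seteqP; split=> u /=; rewrite !in_itv/=.
    by move=> [/andP[h1 h2] h3]; split=> //; apply/andP; split; lra.
  by move=> [/andP[h1 h2] h3]; split=> //; apply/andP; split; lra.
Qed.

(** * Uniqueness of the latitude orbit *)

Lemma is_derive_expR_affine (R : realType) (k s x : R) :
  is_derive x 1 (fun u => expR (k * (u - s))) (k * expR (k * (x - s))).
Proof.
have h1 := is_derive_cmul k (is_derive_sub (is_derive_id x 1) (is_derive_cst s x 1)).
have h2 := @is_derive_comp _ (@expR R) _ _ _ _ (is_derive_expR _) h1.
by apply: is_derive_eq h2 _; rewrite /cst subr0 mulr1 mulrC.
Qed.

(** To the left of s the product e(u) exp(C (u - s)) is nondecreasing, to the right e(u) exp(- C (u
    - s)) is nonincreasing. Both vanish at s, so e is at most 0 on either side. *)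
Lemma gronwall0 (R : realType) (e e' : R -> R) (C s r : R) :
  (forall x, 0 <= e x) -> e s = 0 ->
  (forall x : R, `|x - s| < r -> is_derive x 1 e (e' x) /\ `|e' x| <= C * e x) ->
  forall x, `|x - s| < r -> e x = 0.
Proof.
move=> e0 es de x xs.
have key k y z : `|y - s| < r -> `|z - s| < r -> y < z -> exists2 c, `|c - s| < r &
    e z * expR (k * (z - s)) - e y * expR (k * (y - s)) =
    (e' c + k * e c) * expR (k * (c - s)) * (z - y).
  move=> ys zs yz; have inr c : y <= c <= z -> `|c - s| < r.
    move: ys zs; rewrite !ltr_norml => /andP[h1 h2] /andP[h3 h4] /andP[h5 h6].
    by apply/andP; split; lra.
  have dk c : y <= c <= z -> is_derive c 1 (fun u => e u * expR (k * (u - s)))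
     ((e' c + k * e c) * expR (k * (c - s))).
    move=> /inr/de[d _].
    by apply: is_derive_eq (is_derive_mul d (is_derive_expR_affine k s c)) _; ring.
  have [||c cI ->] := @MVT _ (fun u => e u * expR (k * (u - s)))
    (fun c => (e' c + k * e c) * expR (k * (c - s))) y z yz.
  - by move=> c; rewrite in_itv/= => /andP[h1 h2]; apply: dk; rewrite !ltW.
  - apply: continuous_in_subspaceT => c /[!inE]/= /[!in_itv]/= h.
    exact: is_derive_continuous (dk c h).
  - exists c => //; apply: inr; move: cI; rewrite in_itv/= => /andP[h1 h2].
    by rewrite !ltW.
have ss : `|s - s| < r by rewrite subrr normr0 (le_lt_trans _ xs).
apply/eqP; rewrite eq_le e0 andbT.
case: (ltgtP x s) => [xs'|xs'|->]; last by rewrite es.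
- have [c cs] := key C x s xs ss xs'; rewrite es mul0r sub0r => h.
  have [_ ec] := de c cs; move: ec; rewrite ler_norml => /andP[h1 _].
  have p1 := expR_gt0 (C * (c - s)); have p2 := expR_gt0 (C * (x - s)).
  have : 0 <= (e' c + C * e c) * expR (C * (c - s)) * (s - x).
    have h2 : 0 <= e' c + C * e c by lra.
    by rewrite mulr_ge0 ?(mulr_ge0 h2 (ltW p1))// subr_ge0 ltW.
  by rewrite -h oppr_ge0 pmulr_lle0.
- have [c cs] := key (- C) s x ss xs xs'; rewrite es mul0r subr0 => h.
  have [_ ec] := de c cs; move: ec; rewrite ler_norml => /andP[_ h1].
  have p1 := expR_gt0 (- C * (c - s)); have p2 := expR_gt0 (- C * (x - s)).
  have : (e' c + - C * e c) * expR (- C * (c - s)) * (x - s) <= 0.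
    rewrite -mulrA mulr_le0_ge0//; first lra.
    by rewrite mulr_ge0 ?(ltW p1)// subr_ge0 ltW.
  by rewrite -h pmulr_lle0.
Qed.

(** In a cap chart the Euclidean radius is the distance in latitude to the pole, so continuity of
    local coordinates controls the latitude of a curve passing through a pole. *)
Lemma coordinates_cap (R : realType) (l : R) (z : SS l) (q : 'rV[R]_3) :
  (coordinates North z q -> co0 q ^+ 2 + co1 q ^+ 2 = latitude z ^+ 2) /\
  (coordinates South z q -> co0 q ^+ 2 + co1 q ^+ 2 = (l - latitude z) ^+ 2).
Proof.
split=> -[_ [p [pl -> ->]]]; rewrite latitude_uvec (clamp_id pl) /from_polar !vec3E.
  by rewrite !exprMn -mulrDr cos2Dsin2 mulr1.
by rewrite !exprMn -mulrDr cos2Dsin2 mulr1.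
Qed.

Section flow.
Variables (R : realType) (l : R) (g : R -> R) (t0 : R).
Hypotheses (hg : profile l g) (ht0 : 0 < t0 < l) (hdg : derive1 g t0 != 0).

Let m : R := `|g t0 / derive1 g t0|.
Let X := magnetic_field g m.
Let eps : R := Num.sg (derive1 g t0).
Let w : R := (derive1 g t0)^-1.

Variable c : R -> SS l.
Hypothesis ic : integral_curve X c.

(* A function on SS away from the poles that vanishes exactly on the orbit; it
   needs no choice of the angles. *)
Let E (t phi : R) : R := (t - t0) ^+ 2 + 2 * (1 - eps * sin phi).
Let e (s : R) : R := E (latitude (c s)) (co1 (repr (c s))).
Let e' (t phi : R) : R := 2 * (t - t0) * (m * cos phi) -
  2 * eps * (cos phi * (m * (- derive1 g t * sin phi / g t) + 1)).

Lemma eps_sin_le1 (phi : R) : eps * sin phi <= 1.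
Proof.
apply: (le_trans (ler_norm _)); rewrite normrM normr_sg hdg mul1r; exact: sin_max.
Qed.

Lemma orbit_defect_ge0 (t phi : R) : 0 <= E t phi.
Proof. by rewrite addr_ge0 ?sqr_ge0// mulr_ge0// subr_ge0 eps_sin_le1. Qed.

Lemma orbit_defect_eq0 (t phi : R) : E t phi = 0 <-> t = t0 /\ sin phi = eps.
Proof.
have e2 : eps * eps = 1 by exact: sgr_derive1_sqr.
split=> [|[tE sE]]; last by rewrite /E tE sE e2; ring.
move=> /eqP; rewrite paddr_eq0 ?sqr_ge0//; last by rewrite mulr_ge0// subr_ge0 eps_sin_le1.
move=> /andP[]; rewrite sqrf_eq0 subr_eq0 => /eqP -> /eqP h; split=> //.
have h1 : eps * sin phi = 1 by lra.
by rewrite -[LHS]mul1r -e2 -mulrA h1 mulr1.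
Qed.

Lemma integral_curve_inner (s : R) : 0 < latitude (c s) < l ->
  exists q : R -> 'rV[R]_3, [/\
    (\forall u \near s, 0 < co0 (q u) < l /\ c u = uvec l (q u)),
    is_derive s 1 q (X Polar (q s)) & (0 < co0 (q s) < l /\ c s = uvec l (q s))].
Proof.
move=> cs; have := ic s; rewrite chart_at_inner// => -[q [qc dq]].
have nq : \forall u \near s, 0 < co0 (q u) < l /\ c u = uvec l (q u).
  by apply: filterS qc => u /coordinates_polar.
by exists q; split=> //; exact: (nbhs_singleton nq).
Qed.

Lemma inner_coordE (z : SS l) (q : 'rV[R]_3) : 0 < co0 q < l -> z = uvec l q ->
  [/\ latitude z = co0 q, eq_angle (co1 q) (co1 (repr z)) & eq_angle (co2 q) (co2 (repr z))].
Proof.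
move=> ql ->; have [h0 h1] := andP ql.
have zl : latitude (uvec l q) = co0 q by rewrite latitude_uvec clamp_id// !ltW.
have /inner_uvecP[] : uvec l q = uvec l (repr (uvec l q)) by rewrite uvec_repr.
  by [].
by move=> _ h2 h3; split.
Qed.

Lemma is_derive_orbit_defect (s : R) : 0 < latitude (c s) < l ->
  is_derive s 1 e (e' (latitude (c s)) (co1 (repr (c s)))).
Proof.
move=> cs; have [q [qc dq [qs1 qs2]]] := integral_curve_inner cs.
have [-> hphi _] := inner_coordE qs1 qs2.
have -> : e' (co0 (q s)) (co1 (repr (c s))) = e' (co0 (q s)) (co1 (q s)).
  by rewrite /e' (eq_angle_sin hphi) (eq_angle_cos hphi).
have dE : is_derive s 1 (fun u => E (co0 (q u)) (co1 (q u))) (e' (co0 (q s)) (co1 (q s))).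
  have /is_derive_row d := dq.
  have d0 := is_derive_sub (d 0) (is_derive_cst t0 s 1).
  have d1 := @is_derive_comp _ (@sin R) (fun u => co1 (q u)) _ _ _ (is_derive_sin _) (d 1).
  have d2 := is_derive_cmul 2 (is_derive_sub (is_derive_cst (1 : R) s 1) (is_derive_cmul eps d1)).
  apply: is_derive_eq (is_derive_add (is_derive_mul d0 d0) d2) _.
  by rewrite /X /magnetic_field /cst !mxE /= /e'; ring.
apply: near_eq_is_derive dE; apply: filterS qc => u [u1 u2].
by have [h1 h2 _] := inner_coordE u1 u2; rewrite /e h1 /E (eq_angle_sin h2).
Qed.

(** Put a = |t - t0|, b = |cos phi|, d = 1 - eps sin phi. From cos^2 = (1 - eps sin)(1 + eps sin)
    one gets b^2 <= 2 d, hence 2 a b <= a^2 + 2 d = E. The phi-component of the field is at most d +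
    K a in absolute value, so |e'| <= 2 m a b + 2 b d + 2 K a b <= (m + 1 + K) E. *)
Lemma orbit_defect_gronwall : exists C : R, \forall t \near t0, 0 < t < l /\
  forall phi, `|e' t phi| <= C * E t phi.
Proof.
have g0 : 0 < g t0 by exact: profile_t0_gt0 ht0.
have sg := smooth_profile hg.
have mE' : m * eps = g t0 / derive1 g t0.
  transitivity (eps * eps * (g t0 / derive1 g t0)).
    by rewrite /m (orbit_speedE hg ht0 hdg) -/eps; ring.
  by rewrite (sgr_derive1_sqr hdg : eps * eps = 1) mul1r.
(* This is m eps g'(t) / g(t). It equals 1 at t0 and is differentiable there, so its slope k bounds
   1 - h(t) by a multiple of |t - t0|. *)
pose h t := g t0 / derive1 g t0 * (derive1 g t * (g t)^-1).
have [dh hd] : exists dh, is_derive t0 1 h dh.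
  have d1 := smooth_is_derive1 t0 (smooth_derive1 sg).
  have d2 := smooth_is_derive1 t0 sg.
  have d3 : is_derive t0 1 (fun t => (g t)^-1) (- (g t0) ^- 2 *: derive1 g t0).
    by apply: is_deriveV; rewrite gt_eqF.
  by eexists; exact: is_derive_cmul (is_derive_mul d1 d3).
have h1 : h t0 = 1 by rewrite /h; field; rewrite hdg gt_eqF.
have /is_derive1_caratheodory[k [hk ck _]] := hd.
exists (m + 1 + (`|k t0| + 1)).
have nk : \forall t \near t0, `|k t| <= `|k t0| + 1.
  have /cvgrPdist_lt/(_ 1 ltr01) := ck; apply: filterS => t kt.
  rewrite -lerBlDl; apply: le_trans (ltW kt); rewrite distrC; exact: lerB_dist.
have [t0_gt0 t0_ltl] := andP ht0.
near=> t; split.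
  by apply/andP; split; near: t; [exact: lt_nbhsr|exact: lt_nbhsl].
move=> phi; have kt : `|k t| <= `|k t0| + 1 by near: t.
have ht : 1 - h t = - (k t * (t - t0)) by rewrite -h1 -hk opprB.
set a := `|t - t0|; set b := `|cos phi|; set d := 1 - eps * sin phi.
have d0 : 0 <= d by rewrite subr_ge0 eps_sin_le1.
have a0 : 0 <= a by exact: normr_ge0.
have b0 : 0 <= b by exact: normr_ge0.
have b1 : b <= 1 by exact: cos_max.
have e2 : eps * eps = 1 by exact: sgr_derive1_sqr.
have bd : b ^+ 2 <= 2 * d.
  rewrite /b real_normK ?num_real// cos2sin2 /d.
  have -> : 1 - sin phi ^+ 2 = (1 - eps * sin phi) * (1 + eps * sin phi).
    transitivity (1 - (eps * eps) * sin phi ^+ 2); last by ring.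
    by rewrite e2 mul1r.
  by have := eps_sin_le1 phi; rewrite -subr_ge0; nra.
have a2 : (t - t0) ^+ 2 = a ^+ 2 by rewrite /a real_normK ?num_real.
have m0 : 0 <= m by exact: normr_ge0.
have K0 : 0 <= `|k t0| + 1 by rewrite addr_ge0.
have hbr : `|m * (- derive1 g t * sin phi / g t) + 1| <= d + (`|k t0| + 1) * a.
  have -> : m * (- derive1 g t * sin phi / g t) + 1 = d + eps * sin phi * (1 - h t).
    rewrite /d /h -mE' -[X in X + 1 = _]mul1r -[X in X * _ + 1 = _]e2; ring.
  apply: (le_trans (ler_normD _ _)); rewrite ger0_norm// lerD2l ht.
  rewrite normrM normrN normrM normrM normr_sg hdg mul1r -/a.
  have s1 := sin_max phi; have s0 := normr_ge0 (sin phi); have k0 := normr_ge0 (k t).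
  have : `|k t| * a <= (`|k t0| + 1) * a by rewrite ler_wpM2r.
  have : 0 <= `|k t| * a by rewrite mulr_ge0.
  by nra.
have e'le : `|e' t phi| <= 2 * a * (m * b) + 2 * (b * (d + (`|k t0| + 1) * a)).
  rewrite /e'; apply: (le_trans (ler_normB _ _)); apply: lerD.
    by rewrite !normrM (ger0_norm m0) ger0_norm.
  rewrite !normrM normr_sg hdg mulr1 ger0_norm// ler_wpM2l// ler_wpM2l//.
apply: (le_trans e'le); rewrite /E a2 -/d.
have ab : 2 * (a * b) <= a ^+ 2 + 2 * d.
  by have := sqr_ge0 (a - b); nra.
have h3 : m * (2 * (a * b)) <= m * (a ^+ 2 + 2 * d) by rewrite ler_wpM2l.
have h4 : (`|k t0| + 1) * (2 * (a * b)) <= (`|k t0| + 1) * (a ^+ 2 + 2 * d).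
  by rewrite ler_wpM2l.
have h5 : b * d <= d by rewrite -[leRHS]mul1r ler_wpM2r.
have h6 : 0 <= a ^+ 2 by exact: sqr_ge0.
by nra.
Unshelve. all: by end_near. Qed.

Let on_orbit (s : R) : Prop := latitude (c s) = t0 /\ sin (co1 (repr (c s))) = eps.

Lemma row_continuous (q : R -> 'rV[R]_3) (s : R) (d : 'rV[R]_3) (i : 'I_3) :
  is_derive s 1 q d -> {for s, continuous (fun u => q u ord0 i)}.
Proof. by move=> /is_derive_row/(_ i); exact: is_derive_continuous. Qed.

Lemma on_orbit_open (s : R) : on_orbit s -> \forall u \near s, on_orbit u.
Proof.
move=> [s1 s2]; have sl : 0 < latitude (c s) < l by rewrite s1.
have [q [qc dq [qs1 qs2]]] := integral_curve_inner sl.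
have [s3 _ _] := inner_coordE qs1 qs2.
have [C nC] := orbit_defect_gronwall.
have cq : co0 (q u) @[u --> s] --> t0 by rewrite -s1 s3; exact: row_continuous dq.
have [r /= r0 hr] := (nbhs_normP _ _).1 (filterI qc (cq _ nC)).
have de u : `|u - s| < r -> is_derive u 1 e (e' (latitude (c u)) (co1 (repr (c u)))) /\
    `|e' (latitude (c u)) (co1 (repr (c u)))| <= C * e u.
  move=> us; have /hr[[u1 u2] [_ u3]] : ball_ Num.norm s r u by rewrite /ball_ /= distrC.
  have [u4 _ _] := inner_coordE u1 u2.
  split; first by apply: is_derive_orbit_defect; rewrite u4.
  by rewrite /e u4; exact: u3.
have es : e s = 0 by apply/orbit_defect_eq0.
have e0 u : 0 <= e u by exact: orbit_defect_ge0.
apply/nbhs_normP; exists r => // u us; apply/orbit_defect_eq0.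
by apply: (gronwall0 e0 es de); rewrite distrC.
Qed.

(** Between the poles E is continuous in the local coordinates and stays nonzero. At a pole only the
    latitude is compared: it remains nearer to the pole than t0 is. *)
Lemma on_orbit_closed (s : R) : ~ on_orbit s -> \forall u \near s, ~ on_orbit u.
Proof.
move=> ns; have [t0_gt0 t0_ltl] := andP ht0.
have [sl|] := boolP (0 < latitude (c s) < l).
  have [q [qc dq [qs1 qs2]]] := integral_curve_inner sl.
  pose F u := E (co0 (q u)) (co1 (q u)).
  have eF u : 0 < co0 (q u) < l -> c u = uvec l (q u) -> on_orbit u <-> F u = 0.
    move=> u1 u2; have [h1 h2 _] := inner_coordE u1 u2.
    by rewrite /on_orbit h1 -(eq_angle_sin h2) -orbit_defect_eq0.
  have F0 : F s != 0 by apply/eqP => /(eF _ qs1 qs2).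
  have cF : {for s, continuous F}.
    have c0 := row_continuous (i := 0) dq; have c1 := row_continuous (i := 1) dq.
    have cs : {for s, continuous (fun u => sin (co1 (q u)))}.
      by apply: (@continuous_comp _ _ _ (fun u => co1 (q u)) (@sin R)) => //; exact: continuous_sin.
    have c2 : {for s, continuous (fun u => co0 (q u) - t0)}.
      by apply: continuousB => //; exact: cst_continuous.
    apply: continuousD; first by apply: continuousM.
    apply: continuousM; first exact: cst_continuous.
    apply: continuousB; first exact: cst_continuous.
    by apply: continuousM => //; exact: cst_continuous.
  have nF : \forall u \near s, F u != 0.
    apply: (@cvgr_neq0 _ _ _ (nbhs s) _ F (F s)) => //; exact: cF.
  by apply: filterS2 qc nF => u [u1 u2] Fu /(eF _ u1 u2) /eqP; rewrite (negbTE Fu).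
rewrite negb_and -!leNgt => sl.
have [p zp pl] : exists2 p, uvec l p = c s & 0 <= latitude (c s) <= l.
  exists (repr (c s)); first exact: uvec_repr.
  rewrite /latitude /clamp /Num.max /Num.min; have l0 := lt_trans t0_gt0 t0_ltl.
  by case: (ltP _ l) => h1; case: (ltP 0 _) => h2; apply/andP; split; lra.
have cap (i : chart) (q : R -> 'rV[R]_3) (d : 'rV[R]_3) (b : R) :
    (\forall u \near s, co0 (q u) ^+ 2 + co1 (q u) ^+ 2 = (b - latitude (c u)) ^+ 2) ->
    is_derive s 1 q d -> latitude (c s) = b -> b != t0 ->
    \forall u \near s, ~ on_orbit u.
  move=> qE dq sb bt.
  have c0 := row_continuous (i := 0) dq; have c1 := row_continuous (i := 1) dq.
  pose F u := co0 (q u) ^+ 2 + co1 (q u) ^+ 2.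
  have cF : F u @[u --> s] --> F s by exact: cvgD (cvgM c0 c0) (cvgM c1 c1).
  have Fs : F s = 0 by rewrite /F (nbhs_singleton qE) sb subrr expr0n.
  have bt2 : 0 < (b - t0) ^+ 2 by rewrite lt_def sqr_ge0 sqrf_eq0 subr_eq0 bt.
  have nF : \forall u \near s, F u < (b - t0) ^+ 2.
    by apply: (@cvgr_lt _ _ (nbhs s) _ F (F s)) => //; rewrite Fs.
  by apply: filterS2 qE nF => u qu Fu [h _]; move: Fu; rewrite /F qu h ltxx.
have := ic s; rewrite /chart_at; have [z0|z0] := eqVneq (latitude (c s)) 0.
  move=> [q [qc dq]]; apply: (cap North q _ 0 _ dq z0); last by rewrite lt_eqF.
  apply: filterS qc => u /(coordinates_cap _ _).1 ->.
  by rewrite sub0r sqrrN.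
have [zl|zl] := eqVneq (latitude (c s)) l.
  move=> [q [qc dq]]; apply: (cap South q _ l _ dq zl); last by rewrite gt_eqF.
  by apply: filterS qc => u /(coordinates_cap _ _).2 ->.
by move: sl pl z0 zl => /orP[] h /andP[h1 h2]; rewrite eq_le ?h ?h1 ?h2 //= => h3; rewrite eq_le h h2.
Qed.

Lemma on_orbit_forall (s0 : R) : on_orbit s0 -> forall s, on_orbit s.
Proof.
move=> h0 s; have cT : connected [set: R] by apply/connected_intervalP.
suff oT : [set u | on_orbit u] = setT by have : [set: R] s by []; rewrite -oT.
apply: cT.
- by exists s0.
- exists [set u | on_orbit u]; last by rewrite setTI.
  by rewrite openE => u; exact: on_orbit_open.
- exists [set u | on_orbit u]; last by rewrite setTI.
  rewrite -[X in closed X]setCK; apply: open_closedC.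
  by rewrite openE => u; exact: on_orbit_closed.
Qed.

Lemma integral_curve_unique (u : R) : c 0 = latitude_orbit l g t0 u ->
  forall s, c s = latitude_orbit l g t0 (u + s).
Proof.
move=> c0.
have [h1 h2 h3] : [/\ latitude (c 0) = t0, eq_angle (eps * (pi / 2)) (co1 (repr (c 0))) &
    eq_angle (0 + u * w) (co2 (repr (c 0)))].
  have := @inner_coordE (c 0) (vec3 t0 (eps * (pi / 2)) (0 + u * w)).
  by rewrite !vec3E; apply.
have on := @on_orbit_forall 0 _; have {}on : forall s, on_orbit s.
  by apply: on; split=> //; rewrite -(eq_angle_sin h2); exact: sin_phi0.
(* Once the curve is known to stay on the orbit, only the longitude remains. Both curves turn with
   speed w, and the cosine of the difference does not depend on the representative, has derivative 0
   and equals 1 at s = 0. *)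
pose f s := cos (co2 (repr (c s)) - (0 + (u + s) * w)).
have df (s : R) : is_derive s 1 f 0.
  have [s1 s2] := on s; have sl : 0 < latitude (c s) < l by rewrite s1.
  have [q [qc dq [qs1 qs2]]] := integral_curve_inner sl.
  have [s3 s4 _] := inner_coordE qs1 qs2.
  have XE : X Polar (q s) = vec3 0 0 w.
    apply: (magnetic_field_t0 hg ht0 hdg); first by rewrite -s3.
    apply: sincos_eq_angle; rewrite ?sin_phi0 ?(cos_phi0 hdg) ?(eq_angle_sin s4)//.
    apply: sin1cos0; rewrite (eq_angle_sin s4) s2 normr_sg hdg//.
  have /is_derive_row/(_ 2) := dq; rewrite XE vec3E => d2.
  have d3 := is_derive_mul (is_derive_add (is_derive_cst u s 1) (is_derive_id s 1)) (is_derive_cst w s 1).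
  have d4 := is_derive_sub d2 (is_derive_add (is_derive_cst (0 : R) s 1) d3).
  have d5 := @is_derive_comp _ (@cos R) _ _ _ _ (is_derive_cos _) d4.
  have dF : is_derive s 1 (fun s => cos (co2 (q s) - (0 + (u + s) * w))) 0.
    by apply: is_derive_eq d5 _; rewrite /cst; ring.
  apply: near_eq_is_derive dF; apply: filterS qc => v [v1 v2].
  have [_ _ [k hk]] := inner_coordE v1 v2.
  rewrite /f hk; apply: eq_angle_cos; by exists k; ring.
move=> s; have fs : f s = 1.
  rewrite (is_derive_0_is_cst s 0 df) /f addr0.
  have [k ->] := h3; rewrite addrAC subrr add0r -[RHS](@cos0 R).
  by apply/esym/eq_angle_cos; exists k; rewrite add0r.
have [s1 s2] := on s.
have sl : 0 < co0 (repr (c s)) < l by rewrite inner_repr s1.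
rewrite -[LHS]uvec_repr; apply/inner_uvecP => //.
rewrite !vec3E inner_repr s1//; split=> //.
  apply: sincos_eq_angle; rewrite ?sin_phi0 ?(cos_phi0 hdg)//.
  by apply: sin1cos0; rewrite s2 normr_sg hdg.
apply: eq_angle_sym; have [k hk] := cos1_eq_angle fs.
have hk' : co2 (repr (c s)) = 0 + (u + s) * w + 2 * pi * k%:~R.
  by rewrite -[LHS](subrK (0 + (u + s) * w)) hk; ring.
by exists k.
Qed.

End flow.

(** * The action *)

(* For t < 0 the integral over [0, t] is 0, so prim is not smooth at 0; the
   antiderivative is its smooth extension. *)
Lemma prim_antiderivative (R : realType) (g : R -> R) (t : R) : smooth g -> 0 <= t ->
  prim g t = antiderivative g t - 1.
Proof.
move=> sg; rewrite le_eqVlt => /predU1P[<-|t_gt0]; rewrite /prim.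
  by rewrite set_itv1 Rintegral_set1 antiderivative0; ring.
rewrite (_ : \int[_]_(_ in _) _ = antiderivative g t - antiderivative g 0).
  by rewrite antiderivative0; ring.
apply: Rintegral_derive => // x _; first exact: is_derive_antiderivative.
exact: (smooth_continuous (n := 0) sg).
Qed.

Lemma profile_antiderivative (R : realType) (l : R) (g : R -> R) :
  profile l g -> antiderivative g l = 2.
Proof.
move=> [[l0 sg] _ _ _ int2]; have := prim_antiderivative sg (ltW l0).
by rewrite /prim int2 => h; lra.
Qed.

Lemma primitive_exists (R : realType) (l m : R) (g : R -> R) : profile l g ->
  primitive_of_omega l g m (global_form m l g).
Proof.
move=> hg; have [[l0 sg] _ [g0 gl _] ev _] := hg.
split; last by move=> p u v _; exact: global_form_primitive.
apply: smooth_global_form => //; last exact: profile_antiderivative.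
- by split=> // k; have [] := ev k.
- have [sg' dg'] := smooth_reflect l sg; split=> // k.
  by rewrite dg' subr0; have [_ ->] := ev k; rewrite mulr0.
Qed.

(** * Positive magnetic curvature and the sign of the action *)

Lemma curvature_inner (R : realType) (l : R) (g : R -> R) (t : R) : smooth g ->
  0 < t < l -> g t <> 0 -> curvature l g t = - derive1n 2 g t / g t.
Proof.
move=> sg tl gt0; rewrite /curvature.
have itv : \forall s \near t, `]0, l[%classic s.
  by apply: near_in_itvoo; rewrite in_itv/=.
have -> : within `]0, l[ (nbhs t) = nbhs t.
  apply/funext => A; apply/propext; split=> h.
    by apply: filterS2 itv h => x xI; apply.
  by apply: filterS h => x Ax _.
apply: cvg_lim => //.
apply: cvgM; first by apply: cvgN; exact: smooth_continuous.
by apply: cvgV; [exact/eqP|exact: (smooth_continuous (n := 0) sg)].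
Qed.

(* (m g' - g) exp (t / m) has the derivative (m^2 g'' - g) exp (t / m) / m < 0 and
   vanishes at t0, hence m g - Gamma increases on [0, t0] from its value 1 at 0. *)
Lemma pos_action_north (R : realType) (l : R) (g : R -> R) (t0 m : R) :
  profile l g -> 0 < t0 < l -> 0 < m -> m * derive1 g t0 = g t0 ->
  (forall t, 0 < t < l -> m ^+ 2 * derive1n 2 g t < g t) ->
  0 < m * g t0 - prim g t0.
Proof.
move=> hg /andP[t0_gt0 t0l] m0 mt0 K; have [[l0 sg] [g0 gl gp] _ _ _] := hg.
pose W t := (m * derive1 g t - g t) * expR (m^-1 * (t - 0)).
have dW (t : R) : is_derive t 1 W
    (m^-1 * (m ^+ 2 * derive1n 2 g t - g t) * expR (m^-1 * (t - 0))).
  have d1 := smooth_is_derive1 t (smooth_derive1 sg).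
  have d2 := smooth_is_derive1 t sg.
  apply: is_derive_eq (is_derive_mul (is_derive_sub (is_derive_cmul m d1) d2)
    (is_derive_expR_affine m^-1 0 t)) _.
  by rewrite derive1nS derive1n1; field; rewrite gt_eqF.
have Wt t : 0 < t < t0 -> 0 < m * derive1 g t - g t.
  move=> /andP[t_gt0 tt0].
  have [|x xI] := @MVT _ W _ t t0 tt0 (fun x _ => dW x).
    by apply: continuous_subspaceT => x; exact: is_derive_continuous (dW x).
  have -> : W t0 = 0 by rewrite /W mt0 subrr mul0r.
  have /andP[x1 x2] : t < x < t0 by move: xI; rewrite in_itv.
  have xl : 0 < x < l by apply/andP; split; lra.
  move=> h; have : 0 < W t.
    have -> : W t = m^-1 * (g x - m ^+ 2 * derive1n 2 g x) * expR (m^-1 * (x - 0)) * (t0 - t).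
      by rewrite -[LHS]opprK -[- W t]sub0r h; ring.
    by rewrite !mulr_gt0 ?invr_gt0 ?expR_gt0 ?subr_gt0// K.
  by rewrite /W pmulr_lgt0 ?expR_gt0.
pose f t := m * g t - antiderivative g t.
have df (t : R) : is_derive t 1 f (m * derive1 g t - g t).
  exact: is_derive_sub (is_derive_cmul m (smooth_is_derive1 t sg)) (is_derive_antiderivative t sg).
have [|x /[!in_itv]/= xI] := @MVT _ f _ 0 t0 t0_gt0 (fun x _ => df x).
  by apply: continuous_subspaceT => x; exact: is_derive_continuous (df x).
rewrite {2}/f g0 antiderivative0 mulr0 !subr0 => h.
rewrite prim_antiderivative ?ltW// opprB addrCA -/(f t0) h.
by rewrite ltr_wpDr// mulr_ge0 ?ltW// Wt.
Qed.

(** Mirror image of the previous case: (m g' + g) exp (- t / m) has the derivative (m^2 g'' - g) exp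
    (- t / m) / m < 0 and vanishes at t0, hence m g + Gamma decreases on [t0, l] down to its value 1
    at l. *)
Lemma pos_action_south (R : realType) (l : R) (g : R -> R) (t0 m : R) :
  profile l g -> 0 < t0 < l -> 0 < m -> m * derive1 g t0 = - g t0 ->
  (forall t, 0 < t < l -> m ^+ 2 * derive1n 2 g t < g t) ->
  0 < m * g t0 + prim g t0.
Proof.
move=> hg /andP[t0_gt0 t0l] m0 mt0 K; have [[l0 sg] [g0 gl gp] _ _ _] := hg.
pose W t := (m * derive1 g t + g t) * expR (- m^-1 * (t - 0)).
have dW (t : R) : is_derive t 1 W
    (m^-1 * (m ^+ 2 * derive1n 2 g t - g t) * expR (- m^-1 * (t - 0))).
  have d1 := smooth_is_derive1 t (smooth_derive1 sg).
  have d2 := smooth_is_derive1 t sg.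
  apply: is_derive_eq (is_derive_mul (is_derive_add (is_derive_cmul m d1) d2)
    (is_derive_expR_affine (- m^-1) 0 t)) _.
  by rewrite derive1nS derive1n1; field; rewrite gt_eqF.
have Wt t : t0 < t < l -> m * derive1 g t + g t < 0.
  move=> /andP[tt0 tl].
  have [|x xI] := @MVT _ W _ t0 t tt0 (fun x _ => dW x).
    by apply: continuous_subspaceT => x; exact: is_derive_continuous (dW x).
  have /andP[x1 x2] : t0 < x < t by move: xI; rewrite in_itv.
  have -> : W t0 = 0 by rewrite /W mt0 addNr mul0r.
  have xl : 0 < x < l by apply/andP; split; lra.
  rewrite subr0 => h; have : 0 < - W t.
    have -> : - W t = m^-1 * (g x - m ^+ 2 * derive1n 2 g x) * expR (- m^-1 * (x - 0)) * (t - t0).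
      by rewrite h; ring.
    by rewrite !mulr_gt0 ?invr_gt0 ?expR_gt0 ?subr_gt0// K.
  by rewrite oppr_gt0 /W pmulr_llt0 ?expR_gt0.
pose f t := m * g t + antiderivative g t.
have df (t : R) : is_derive t 1 f (m * derive1 g t + g t).
  exact: is_derive_add (is_derive_cmul m (smooth_is_derive1 t sg)) (is_derive_antiderivative t sg).
have [|x /[!in_itv]/= xI] := @MVT _ f _ t0 l t0l (fun x _ => df x).
  by apply: continuous_subspaceT => x; exact: is_derive_continuous (df x).
rewrite {1}/f gl (profile_antiderivative hg) mulr0 add0r => h.
rewrite prim_antiderivative ?ltW// addrA -/(f t0).
have h2 : (m * derive1 g x + g x) * (l - t0) <= 0.
  by rewrite mulr_le0_ge0 ?subr_ge0 ?ltW// Wt.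
by lra.
Qed.

(** * The invariant measure of the orbit and its action *)

Section action.
Variables (R : realType) (l : R) (g : R -> R) (t0 : R).
Hypotheses (hg : profile l g) (ht0 : 0 < t0 < l) (hdg : derive1 g t0 != 0).

Let m : R := `|g t0 / derive1 g t0|.
Let X := magnetic_field g m.
Let eps : R := Num.sg (derive1 g t0).
Let phi0 : R := eps * (pi / 2).
Let w : R := (derive1 g t0)^-1.
Let T : R := 2 * pi * `|derive1 g t0|.
Let c := latitude_orbit l g t0.

Lemma in_strip_orbit s : in_strip l (vec3 t0 phi0 (0 + s * w)).
Proof. by rewrite /in_strip vec3E; have [h0 h1] := andP ht0; rewrite !ltW. Qed.

Lemma measurable_fun_latitude_orbit :
  measurable_fun setT (c : measurableTypeR R -> SSborel l).
Proof.
apply: (@measurability _ _ (measurableTypeR R) (SSborel l) setT c (@SSopen R l)) => //.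
move=> _ [U oU <-]; rewrite setTI; apply: open_measurable.
exact: preimage_uvec_open (@latitude_orbit_continuous R g t0) in_strip_orbit oU.
Qed.

Definition orbit_mfun : {mfun measurableTypeR R >-> SSborel l} :=
  HB.pack (c : measurableTypeR R -> SSborel l)
    (isMeasurableFun.Build _ _ _ _ _ measurable_fun_latitude_orbit).

Definition orbit_probability : probability (SSborel l) R :=
  curve_measure (orbit_period_gt0 hdg) orbit_mfun.

Lemma orbit_probability_orbit_measure : orbit_measure c T orbit_probability.
Proof. by move=> A mA; exact: curve_measureE. Qed.

(** An open null set: it confines the support to the orbit and is where the integrand may be
    replaced. *)
Definition off_orbit : set (SSborel l) := [set z | ~ exists s, z = c s].

Lemma SSopen_off_orbit : SSopen off_orbit.
Proof.
exists (~` ((fun p : 'rV[R]_3 => co0 p) @^-1` [set t0] `&`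
    (fun p : 'rV[R]_3 => sin (co1 p)) @^-1` [set eps])).
  apply: closed_openC; apply: closedI.
    by apply: closed_comp => [p _|]; [exact: coord_continuous3|exact: closed_eq].
  apply: closed_comp => [p _|]; last exact: closed_eq.
  apply: (@continuous_comp _ _ _ (fun p : 'rV[R]_3 => co1 p) (@sin R)).
    exact: coord_continuous3.
  exact: continuous_sin.
move=> p pl; rewrite /off_orbit /=.
have h := latitude_orbitP ht0 hdg pl; rewrite -/c -/eps in h.
by split=> nh; [move=> /h|move=> /h].
Qed.

Lemma measurable_off_orbit : measurable off_orbit.
Proof. by apply: sub_sigma_algebra; exact: SSopen_off_orbit. Qed.

Lemma orbit_probability_off : orbit_probability off_orbit = 0%E.
Proof.
rewrite (orbit_probability_orbit_measure measurable_off_orbit).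
rewrite (_ : c @^-1` off_orbit = set0) ?setI0 ?measure0 ?mule0//.
by rewrite -subset0 => s /=; apply; exists s.
Qed.

(** A measurable replacement of the contracted form, depending on the longitude alone. It is set to
    0 at the poles, where the longitude has no meaning. *)
Let inner_fun (F : R -> R) (z : SSborel l) : R :=
  if 0 < latitude z < l then F (co2 (repr z)) else 0.

Lemma inner_fun_uvec (F : R -> R) (p : 'rV[R]_3) : (forall x, F (x + 2 * pi) = F x) ->
  0 < co0 p < l -> inner_fun F (uvec l p) = F (co2 p).
Proof.
move=> pF pl; have [h1 _ h3] := inner_coordE pl (erefl (uvec l p)).
by rewrite /inner_fun h1 pl; apply/esym/(periodic_eq_angle pF h3).
Qed.

Lemma measurable_inner_fun (F : R -> R) : continuous F ->
  (forall x, F (x + 2 * pi) = F x) -> measurable_fun setT (inner_fun F).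
Proof.
move=> cF pF; apply: (measurability _ (RGenOpens.measurableE R)).
move=> _ [_ [x [y ->] <-]]; rewrite setTI.
pose U (O : set R) : set (SSborel l) := [set z | 0 < latitude z < l /\ O (F (co2 (repr z)))].
have mU O : open O -> measurable (U O).
  move=> openO; apply: sub_sigma_algebra.
  exists ((fun p : 'rV[R]_3 => co0 p) @^-1` `]0, l[ `&`
     (fun p : 'rV[R]_3 => F (co2 p)) @^-1` O).
    apply: openI; apply: open_comp => //.
    - by move=> p _; exact: coord_continuous3.
    - move=> p _; apply: (@continuous_comp _ _ _ (fun p : 'rV[R]_3 => co2 p) F).
        exact: coord_continuous3.
      exact: cF.
  move=> p pl; rewrite /U /= in_itv/= latitude_uvec (clamp_id pl).
  split=> -[p1 p2]; split=> //; have [_ _ h] := inner_coordE p1 (erefl (uvec l p)).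
    by rewrite (periodic_eq_angle pF h).
  by rewrite -(periodic_eq_angle pF h).
(* The second piece is the fibres over the poles, present exactly when the interval contains the
   default value 0. *)
have -> : inner_fun F @^-1` `]x, y[ =
    U `]x, y[%classic `|` (~` (U setT) `&` [set _ | `]x, y[%classic (0 : R)]).
  apply/seteqP; split=> z /=; rewrite /inner_fun /U /=.
    by case: ifPn => zl h; [left|right; split=> // -[]].
  case=> [[-> //]|[zl h]]; case: ifPn => // zl'.
  by exfalso; apply: zl.
apply: measurableU; first by apply: mU; exact: interval_open.
apply: measurableI; first by apply: measurableC; apply: mU; exact: openT.
have [h|h] := pselect (`]x, y[%classic (0 : R)).
  have -> : [set _ : SSborel l | `]x, y[%classic (0 : R)] = setT by apply/seteqP; split.
  exact: measurableT.
have -> : [set _ : SSborel l | `]x, y[%classic (0 : R)] = set0 by apply/seteqP; split.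
exact: measurable0.
Qed.

(** The time average of a(X) along the orbit is the loop integral in theta divided by T, namely w (m
    g eps - Gamma) at t0. Then m eps = g / g' and w = 1 / g' give the formula. *)
Lemma orbit_action (a : form1 R) : primitive_of_omega l g m a ->
  \int[orbit_probability]_z contract_form a X z =
    (g t0 ^+ 2 - derive1 g t0 * prim g t0) / derive1 g t0 ^+ 2.
Proof.
move=> pa; have [sa da] := pa.
have [[l0 sg] [g0 gl gp] _ _ _] := hg.
have [t0_gt0 t0_ltl] := andP ht0.
pose F th := a Polar (vec3 t0 phi0 th) (vec3 0 0 w).
have pF x : F (x + 2 * pi) = F x.
  apply: (polar_periodic sa) => //; first exact: eq_angle_refl.
  by exists (-1); rewrite rmorphN1; ring.
have cF : continuous F.
  move=> x; have [_ sm _ _] := sa.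
  have cv : (fun x => vec3 t0 phi0 x) @ x --> vec3 t0 phi0 x.
    by apply: cvg_vec3; [exact: cvg_cst|exact: cvg_cst|exact: cvg_id].
  have cH : {for vec3 t0 phi0 x, continuous (fun p => a Polar p (vec3 0 0 w))}.
    by have [|] := sm Polar (vec3 0 0 w) [::] (vec3 t0 phi0 x) _ => //=; rewrite vec3E.
  exact: cvg_comp _ _ cv cH.
have fc s : inner_fun F (c s) = F (0 + s * w).
  by rewrite /c /latitude_orbit inner_fun_uvec ?vec3E.
have -> : \int[orbit_probability]_z contract_form a X z =
    \int[orbit_probability]_z inner_fun F z.
  congr fine; apply: (integral_negligible_modification measurable_off_orbit orbit_probability_off).
  move=> z /contrapT[s ->]; congr EFin; rewrite fc.
  have cl : 0 < latitude (c s) < l by rewrite /c latitude_latitude_orbit.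
  have [q [qc ql ->]] := contract_form_inner a X cl.
  have [q0 q1 q2] := (inner_uvecP _ ql).1 qc; rewrite !vec3E in q0 q1 q2.
  rewrite /X (magnetic_field_t0 hg ht0 hdg q0 q1) -/w.
  have -> : q = vec3 t0 (co1 q) (co2 q) by apply: row3P; rewrite vec3E.
  exact: (polar_periodic sa).
rewrite (integral_curve_measure (orbit_period_gt0 hdg) (c := orbit_mfun)); last 2 first.
- exact: measurable_inner_fun.
- move=> s; have -> : (fun s => inner_fun F (orbit_mfun s)) = (fun s => F (0 + s * w)).
    by apply/funext => u; exact: fc.
  apply: (@continuous_comp _ _ _ (fun s : R => 0 + s * w) F); last exact: cF.
  exact: affine_continuous.
have := loop_integral_theta phi0 l0 (orbit_period_gt0 hdg) (angular_speed_period hdg) sg g0 gl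
  (profile_antiderivative hg) pa ht0.
have -> : loop_integral a phi0 0 (derive1 g t0)^-1 (2 * pi * `|derive1 g t0|) t0 =
    \int[lebesgue_measure]_(s in `[0, T]) inner_fun F (orbit_mfun s).
  apply: eq_Rintegral => s _; rewrite [RHS]fc /F /loop mulr0 addr0.
  by [].
move=> ->; rewrite sin_phi0 -/T -/w -/m -/eps.
have mE' : m = eps * g t0 * w by exact: (orbit_speedE hg ht0 hdg).
have e2 : eps * eps = 1 by exact: sgr_derive1_sqr.
rewrite (prim_antiderivative sg (ltW t0_gt0)).
have T0 : T != 0 by rewrite gt_eqF// orbit_period_gt0.
transitivity (w * (1 + (eps * eps) * g t0 * w * g t0 - antiderivative g t0)).
  by rewrite mE' -/T; field.
by rewrite e2 /w; field.
Qed.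

(** By uniqueness of integral curves a flow acts on the orbit as a translation of time, and
    normalised Lebesgue measure on a period does not change under translations of T-periodic
    sets. *)
Lemma orbit_probability_invariant : invariant_measure X orbit_probability.
Proof.
move=> Phi [Phi0 Phic Phio] s A mA.
have mPhi : measurable_fun setT (Phi s : SSborel l -> SSborel l).
  apply: (@measurability _ _ (SSborel l) (SSborel l) setT (Phi s) (@SSopen R l)) => //.
  move=> _ [U oU <-].
  by rewrite setTI; apply: sub_sigma_algebra; exact: Phio.
have mPA : measurable ((Phi s : SSborel l -> SSborel l) @^-1` A).
  by rewrite -[X in measurable X]setTI; exact: mPhi.
rewrite (orbit_probability_orbit_measure mPA) (orbit_probability_orbit_measure mA).
congr (_ * _)%E.
have mcA : measurable (c @^-1` A : set (measurableTypeR R)).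
  by rewrite -[X in measurable X]setTI; exact: measurable_fun_latitude_orbit.
rewrite -(lebesgue_measure_periodic_shift s (orbit_period_gt0 hdg) mcA); last first.
  by move=> u /=; rewrite /c latitude_orbit_periodic.
congr (lebesgue_measure (_ `&` _)); apply/seteqP.
have E u : Phi s (c u) = c (u + s).
  have := integral_curve_unique hg ht0 hdg (Phic (c u)); apply.
  exact: Phi0.
by split=> u /=; rewrite E.
Qed.

Lemma integral_of_motion_supp (z : SS l) : supp orbit_probability z ->
  integral_of_motion g m z = m * g t0 * eps - prim g t0.
Proof.
move=> zs; have [s zE] : exists s, z = c s.
  by apply: contrapT => nz; have := zs _ SSopen_off_orbit nz; rewrite orbit_probability_off ltxx.
have h : 0 < co0 (vec3 t0 phi0 (0 + s * w)) < l by rewrite vec3E.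
have [z0 z1 _] := inner_coordE h zE.
by rewrite /integral_of_motion z0 vec3E -(eq_angle_sin z1) vec3E sin_phi0.
Qed.

End action.

Theorem proposition5p10 (R : realType) (l : R) (g : R -> R) (t0 : R)
    (hg : profile l g) (ht0 : 0 < t0 < l) (hdg : derive1 g t0 != 0) :
  let m := `|g t0 / derive1 g t0| in
  let X := magnetic_field g m in
  let lift := velocity_lift l g (fun=> t0)
                (fun s => Num.sg (derive1 g t0) * s / g t0) in
  exists (c : R -> SS l) (T : R) (zeta : probability (SSborel l) R),
    [/\ periodic_orbit X c T, range c = lift & orbit_measure c T zeta] /\
    [/\ invariant_measure X zeta,
        action_values g m zeta = [set magnetic_action g m zeta],
        magnetic_action g m zeta =
          (g t0 ^+ 2 - derive1 g t0 * prim g t0) / derive1 g t0 ^+ 2,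
        (forall z, supp zeta z ->
           integral_of_motion g m z = derive1 g t0 * magnetic_action g m zeta) &
        (forall t : R, 0 <= t <= l -> 0 < magnetic_curvature l g m t) ->
          0 < magnetic_action g m zeta].
Proof.
move=> m X lift.
exists (latitude_orbit l g t0), (2 * pi * `|derive1 g t0|), (orbit_probability ht0 hdg).
split; first split.
- exact: latitude_orbit_periodic_orbit.
- exact: range_latitude_orbit.
- exact: orbit_probability_orbit_measure.
have g0 : 0 < g t0 by exact: profile_t0_gt0 ht0.
have [t0_gt0 t0_ltl] := andP ht0.
set zeta := orbit_probability ht0 hdg.
set A := (g t0 ^+ 2 - derive1 g t0 * prim g t0) / derive1 g t0 ^+ 2.
(* All primitives give the value A; the explicit one shows that the set is not empty, so the chosen
   element is A. *)
have avE : action_values g m zeta = [set A].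
  apply/seteqP; split=> [_ [a pa <-]|_ ->]; first exact: orbit_action.
  exists (global_form m l g); first exact: primitive_exists.
  by apply: orbit_action => //; exact: primitive_exists.
have actE : magnetic_action g m zeta = A.
  have : action_values g m zeta (magnetic_action g m zeta).
    by apply: getPex; exists A; rewrite avE.
  by rewrite avE.
have e2 := sgr_derive1_sqr hdg.
have mE' : m = Num.sg (derive1 g t0) * g t0 * (derive1 g t0)^-1 by exact: (orbit_speedE hg ht0 hdg).
rewrite actE; split=> //.
- exact: orbit_probability_invariant.
- move=> z /(integral_of_motion_supp) ->; rewrite -/m mE' /A.
  transitivity (Num.sg (derive1 g t0) * Num.sg (derive1 g t0) * g t0 ^+ 2 / derive1 g t0 - prim g t0).
    by ring.
  by rewrite e2; field.
move=> Kpos; have [[l0 sg] [_ _ gp] _ _ _] := hg.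
have m0 : 0 < m by rewrite normr_gt0 mulf_neq0 ?invr_eq0// gt_eqF.
(* Positive magnetic curvature at t, multiplied by g(t) > 0. *)
have K (t : R) : 0 < t < l -> m ^+ 2 * derive1n 2 g t < g t.
  move=> tl; have gt0 := gp t tl; have [t1 t2] := andP tl.
  have := Kpos t; rewrite !ltW// => /(_ isT).
  rewrite /magnetic_curvature curvature_inner//; last by apply/eqP; rewrite gt_eqF.
  rewrite -(pmulr_lgt0 _ gt0) => h.
  have : 0 < g t - m ^+ 2 * derive1n 2 g t.
    suff <- : (m ^+ 2 * (- derive1n 2 g t / g t) + 1) * g t =
      g t - m ^+ 2 * derive1n 2 g t by [].
    by field; rewrite gt_eqF.
  by rewrite subr_gt0.
rewrite /A divr_gt0 ?exprn_even_gt0//.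
(* As m |g'(t0)| = g(t0), the numerator is |g'(t0)| times m g + Gamma if g'(t0) < 0 and |g'(t0)|
   times m g - Gamma if g'(t0) > 0. *)
have [d0|d0|d0] := ltgtP (derive1 g t0) 0; last by have := hdg; rewrite d0 eqxx.
- have md : m * derive1 g t0 = - g t0 by rewrite mE' ltr0_sg//; field.
  have -> : g t0 ^+ 2 - derive1 g t0 * prim g t0 =
      - derive1 g t0 * (m * g t0 + prim g t0).
    have gE : g t0 = - (m * derive1 g t0) by rewrite md opprK.
    by rewrite expr2 {1}gE; ring.
  by rewrite mulr_gt0 ?oppr_gt0//; exact: pos_action_south K.
- have md : m * derive1 g t0 = g t0 by rewrite mE' gtr0_sg//; field.
  have -> : g t0 ^+ 2 - derive1 g t0 * prim g t0 =
      derive1 g t0 * (m * g t0 - prim g t0).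
    by rewrite expr2 -{1}md; ring.
  by rewrite mulr_gt0//; exact: pos_action_north K.
Qed.
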